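(* Let $K$ be a field, $S=K[x_1,\dots,x_n]$, and let $I\subset S$ be a monomial ideal of height $h$ that is of König type with respect to $u_1,\dots,u_h\in G(I)$. Let $f_1,\dots,f_d$ be the special system of parameters of $S/I$ attached to $u_1,\dots,u_h$. The following conditions are equivalent: (i) $S/I$ is Cohen--Macaulay. (ii) $S/I_B$ is Cohen--Macaulay for every $B\subseteq\{f_1,\dots,f_d\}$. (iii) $I_B$ is unmixed for every $B\subseteq\{f_1,\dots,f_d\}$.
   Context: $G(I)$ denotes the unique minimal set of monomial generators of a monomial ideal $I$. A monomial ideal $I$ of height $h$ is of König type with respect to $u_1,\dots,u_h\in G(I)$ if $u_1,\dots,u_h$ is a regular sequence (equivalently, the $u_j$ are pairwise coprime). The sequence attached to $u_1,\dots,u_h$: let $A$ be the set of variables dividing none of the $u_j$; for each $j$ let $B_j$ be the set of variables dividing $u_j$, and let $i_j$ be the smallest index with $x_{i_j}\in B_j$; put $C_j=\{x_{i_j}-x_k : x_k\in B_j,\ k\ne i_j\}$ and $C=A\cup C_1\cup\dots\cup C_h$ (the sign of the differences is chosen so that each difference has the form $x_i-x_j$ with $i<j$). Then $|C|=n-h=d=\dim S/I$, and $\{f_1,\dots,f_d\}=C$. It is known that $C$ is a system of parameters of $S/I$. For $B\subseteq\{f_1,\dots,f_d\}$, $I_B\subset S$ denotes the ideal obtained from $I$ by replacing, in all monomials of $I$ (equivalently in its generators), the variable $x_j$ by $x_i$ for every element of $B$ of the form $x_i-x_j$ with $i<j$ (elements of $B$ that are single variables have no effect). An ideal is unmixed if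 all its associated prime ideals have the same height. *)

(* Defs.v *)
From mathcomp Require Import all_boot all_order all_algebra.
From mathcomp Require Import boolp classical_sets.
From mathcomp Require Import mpoly.

Set Implicit Arguments.
Unset Strict Implicit.
Unset Printing Implicit Defensive.

Import GRing.Theory.

Local Open Scope classical_set_scope.
Local Open Scope ring_scope.

Section CommutativeAlgebra.
Variable R : comNzRingType.
Implicit Types (I P : set R) (s : seq R) (c : nat -> set R).

Definition is_ideal I : Prop :=
  [/\ I 0, (forall a b, I a -> I b -> I (a + b)) & (forall r a, I a -> I (r * a))].

Definition ideal_gen (G : set R) : set R := smallest is_ideal G.

Definition is_prime P : Prop :=
  [/\ is_ideal P, ~ P 1 & forall a b, P (a * b) -> P a \/ P b].

(* c 0 < c 1 < ... < c d, all prime; the values of c beyond d are irrelevant *)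
Definition prime_chain c (d : nat) : Prop :=
  (forall i, (i <= d)%N -> is_prime (c i)) /\
  (forall i, (i < d)%N -> c i `<` c i.+1).

Definition prime_height P (h : nat) : Prop :=
  (exists c, prime_chain c h /\ c h = P) /\
  (forall c d, prime_chain c d -> c d = P -> (d <= h)%N).

Definition ideal_height I (h : nat) : Prop :=
  (exists P, [/\ is_prime P, I `<=` P & prime_height P h]) /\
  (forall P k, is_prime P -> I `<=` P -> prime_height P k -> (h <= k)%N).

(* Krull dimension of R/I *)
Definition quot_dim I (d : nat) : Prop :=
  (exists c, prime_chain c d /\ I `<=` c 0%N) /\
  (forall c k, prime_chain c k -> I `<=` c 0%N -> (k <= d)%N).

(* P belongs to Ass(R/I) *)
Definition associated_prime I P : Prop :=
  is_prime P /\ exists f, P = [set g | I (g * f)].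

Definition unmixed I : Prop :=
  exists h, forall P, associated_prime I P -> prime_height P h.

Definition add_gens I s : set R := ideal_gen (I `|` [set` s]).

(* s is a regular sequence on the module R/I *)
Definition regular_seq I s : Prop :=
  (forall i, (i < size s)%N ->
     forall g, add_gens I (take i s) (s`_i * g) -> add_gens I (take i s) g) /\
  ~ add_gens I s 1.

End CommutativeAlgebra.

Section PolynomialRing.
Variables (K : fieldType) (n : nat).
Implicit Types (I : set {mpoly K[n]}) (m : 'X_{1..n}).

(* The depth of S/I in the graded sense: the supremum of the lengths of the
   (S/I)-regular sequences of homogeneous elements of positive degree. *)
Definition homog_pos (f : {mpoly K[n]}) : Prop :=
  exists2 d, (0 < d)%N & f \is d.-homog.

Definition quot_depth I (d : nat) : Prop :=
  (exists s : seq {mpoly K[n]},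
     [/\ {in s, forall f, homog_pos f}, regular_seq I s & size s = d]) /\
  (forall s : seq {mpoly K[n]},
     {in s, forall f, homog_pos f} -> regular_seq I s -> (size s <= d)%N).

(* S/I is Cohen-Macaulay; meant for homogeneous I *)
Definition quot_CM I : Prop := exists2 d, quot_dim I d & quot_depth I d.

Definition mono_ideal (G : set 'X_{1..n}) : set {mpoly K[n]} :=
  ideal_gen ((fun m => 'X_[m]) @` G).

Definition monomial_ideal I : Prop := exists G, I = mono_ideal G.

(* The minimal generating sets of monomials form a singleton {G(I)} when I is
   a monomial ideal, so that the union [min_gens I] of all of them is G(I). *)
Definition is_min_gens I (G : set 'X_{1..n}) : Prop :=
  I = mono_ideal G /\
  forall G', G' `<=` G -> I = mono_ideal G' -> G' = G.

Definition min_gens I : set 'X_{1..n} := [set m | exists2 G, is_min_gens I G & G m].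

Definition koenig_type I (h : nat) (u : h.-tuple 'X_{1..n}) : Prop :=
  [/\ ideal_height I h, (forall j, min_gens I (tnth u j))
    & regular_seq [set 0 : {mpoly K[n]}] [seq 'X_[m] | m <- u]].

(* 'X_i divides 'X_[m] *)
Definition occurs (i : 'I_n) m : Prop := (0 < m i)%N.

Definition first_var (i : 'I_n) m : Prop :=
  occurs i m /\ forall k, occurs k m -> (i <= k)%N.

(* the set {f_1, ..., f_d} attached to u *)
Definition special_sop (h : nat) (u : h.-tuple 'X_{1..n}) : set {mpoly K[n]} :=
  [set f | (exists i, (forall j, ~ occurs i (tnth u j)) /\ f = 'X_i) \/
           (exists j i k, [/\ first_var i (tnth u j), occurs k (tnth u j),
                              k != i & f = 'X_i - 'X_k])].

(* The index of the variable by which 'X_j is replaced.  For B contained in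
   special_sop u, with the u_j pairwise coprime, at most one i qualifies, and
   'X_i is itself left unchanged. *)
Definition repl (B : set {mpoly K[n]}) (j : 'I_n) : 'I_n :=
  odflt j [pick i : 'I_n | (i < j)%N && ('X_i - 'X_j \in B)].

Definition repl_ideal I (B : set {mpoly K[n]}) : set {mpoly K[n]} :=
  ideal_gen [set p | exists2 m, I 'X_[m]
                   & p = 'X_[m] \mPo [tuple 'X_(repl B j) | j < n]].

End PolynomialRing.

(* Main.v *)
Require Import Defs.
From mathcomp Require Import all_boot all_order all_algebra.
From mathcomp Require Import boolp classical_sets.
From mathcomp Require Import mpoly.
From mathcomp Require Import ring zify.

Set Implicit Arguments.
Unset Strict Implicit.
Unset Printing Implicit Defensive.

Import GRing.Theory.

Local Open Scope classical_set_scope.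
Local Open Scope ring_scope.

(** The elements [x_i - x_j] of the special system of parameters identify
variables of a block (the variables of some [u_l]) with the first variable of the
block. For a set [B] of such differences, renaming variables embeds the quotient
of [S] by [I] and [B] into [S/I_B]: a polynomial lies in
[I + (B)] if and only if its renaming lies in [I_B] ([add_gens_diffs]). All the
ideals that occur are thus governed by monomial ideals, and the whole proof
revolves around one property of these: each prime associated to [I_B] is
generated by exactly [h] variables ([height_pure]).

Such a prime contains a variable of each of the [h] disjoint blocks, because the
image of [u_l] in [I_B] involves only variables of its block. Hence it
has at least [h] variables, and more than [h] if it contains two variables of
one block or a variable outside of all blocks ([annihilates_card_extra]).
Since [I] has height [h], some associated prime has exactly [h] variables, so
purity is the same as unmixedness ([unmixed_pure]).

Purity implies the Cohen-Macaulay property. If [x_i - x_j] is a zerodivisor on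
[S/I_B], then some monomial outside of [I_B] is killed by both [x_i] and [x_j]
([nonzerodivisor_diff]), so that some associated prime contains two variables of
a block; similarly a free variable that is a zerodivisor lies in an associated
prime. Purity excludes both, and the special system of parameters is a regular
sequence on each [S/I_B] ([pure_CM]).

The Cohen-Macaulay property implies purity. This is Ischebeck's inequality:
if [S/J] has a regular sequence of length [d] and [f_1, ..., f_b] is
another regular sequence on [S/J], a prime associated to [S/(J + (f))] has
coheight at least [d - b]. It is proved by elementary cohomology: a variant of the
Koszul complex without alternation, in which every required
homotopy is evaluation at the first argument. A regular sequence makes the
cohomology vanish below its length, each [f_i] costs one degree, and so does each
generator that is dropped from the maximal ideal to reach the associated
prime ([annihilated_by_few]). Starting from [S/I] Cohen-Macaulay, this bound and
the regularity criterion for differences alternate: regular differences give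
purity of the collapsed ideal, purity makes the next difference regular
([CM_pure_all]).

Dimensions and heights are reduced to the bound [n] for the length of a chain of
primes in [n] variables, which follows from the algebraic dependence of [n.+1]
polynomials ([prime_chain_bound]). *)

(** * Ideals and regular sequences *)

Section Ideals.
Variable R : comNzRingType.
Implicit Types (I J L : set R) (s : seq R).

Lemma ideal0 I : is_ideal I -> I 0. Proof. by case. Qed.

Lemma idealD I a b : is_ideal I -> I a -> I b -> I (a + b).
Proof. by case=> _ h _; apply: h. Qed.

Lemma idealMl I r a : is_ideal I -> I a -> I (r * a).
Proof. by case=> _ _; apply. Qed.

Lemma idealMr I r a : is_ideal I -> I a -> I (a * r).
Proof. by rewrite mulrC; apply: idealMl. Qed.

Lemma idealN I a : is_ideal I -> I a -> I (- a).
Proof. by move=> iI; rewrite -mulN1r; apply: idealMl. Qed.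

Lemma idealB I a b : is_ideal I -> I a -> I b -> I (a - b).
Proof. by move=> iI Ia Ib; apply: idealD => //; apply: idealN. Qed.

Lemma idealBr I a b : is_ideal I -> I (a - b) -> I b -> I a.
Proof. by move=> iI Iab Ib; rewrite -(subrK b a); apply: idealD. Qed.

Lemma ideal_sum I (T : Type) (r : seq T) (P : pred T) (F : T -> R) :
  is_ideal I -> (forall i, P i -> I (F i)) -> I (\sum_(i <- r | P i) F i).
Proof. by move=> iI; apply: (big_ind I); [apply: ideal0|move=> *; apply: idealD]. Qed.

Lemma ideal_gen_ideal G : is_ideal (ideal_gen (R := R) G).
Proof.
split=> [I [/ideal0]|a b Ga Gb I [iI GI]|r a Ga I [iI GI]] //.
- by apply: idealD => //; [apply: Ga|apply: Gb].
- by apply: idealMl => //; apply: Ga.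
Qed.

Lemma sub_ideal_gen (G : set R) : G `<=` ideal_gen G.
Proof. exact: sub_gen_smallest. Qed.

Lemma ideal_gen_sub G I : is_ideal I -> G `<=` I -> ideal_gen G `<=` I.
Proof. exact: smallest_sub. Qed.

Lemma add_gens_ideal I s : is_ideal (add_gens I s).
Proof. exact: ideal_gen_ideal. Qed.

Lemma sub_add_gens I s : I `<=` add_gens I s.
Proof. by move=> a Ia; apply: sub_ideal_gen; left. Qed.

Lemma mem_add_gens I s a : a \in s -> add_gens I s a.
Proof. by move=> sa; apply: sub_ideal_gen; right. Qed.

Lemma add_gens_sub I s J :
  is_ideal J -> I `<=` J -> (forall a, a \in s -> J a) -> add_gens I s `<=` J.
Proof. by move=> iJ IJ sJ; apply: ideal_gen_sub => // a [/IJ|/sJ]. Qed.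

Lemma add_gens0 I : is_ideal I -> add_gens I [::] = I.
Proof.
by move=> iI; apply/seteqP; split; [apply: add_gens_sub|apply: sub_add_gens].
Qed.

Lemma add_gens_cat I s1 s2 : add_gens I (s1 ++ s2) = add_gens (add_gens I s1) s2.
Proof.
apply/seteqP; split; apply: add_gens_sub; try exact: add_gens_ideal.
- by move=> a Ia; do 2 apply: sub_add_gens.
- move=> a; rewrite mem_cat => /orP[sa|sa]; last exact: mem_add_gens.
  by apply: sub_add_gens; apply: mem_add_gens.
- apply: add_gens_sub; first exact: add_gens_ideal.
  + exact: sub_add_gens.
  + by move=> a sa; apply: mem_add_gens; rewrite mem_cat sa.
- by move=> a sa; apply: mem_add_gens; rewrite mem_cat sa orbT.
Qed.

Lemma add_gens1P I z a : is_ideal I ->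
  add_gens I [:: z] a <-> exists r j, I j /\ a = j + z * r.
Proof.
move=> iI; split=> [|[r [j [Ij ->]]]]; last first.
  apply: (idealD (add_gens_ideal _ _)); first exact: sub_add_gens.
  by apply: (idealMr _ (add_gens_ideal _ _)); apply: mem_add_gens; rewrite inE.
pose J := [set a | exists r j, I j /\ a = j + z * r].
suff JJ : add_gens I [:: z] `<=` J by move=> /JJ.
apply: add_gens_sub => [|b Ib|b].
- split; first by exists 0, 0; rewrite mulr0 addr0; split; [apply: ideal0|].
  + move=> _ _ [r [j [Ij ->]]] [r' [j' [Ij' ->]]].
    exists (r + r'), (j + j'); split; first exact: idealD.
    by ring.
  + move=> c _ [r [j [Ij ->]]]; exists (c * r), (c * j).
    by split; [apply: idealMl|ring].
- by exists 0, b; rewrite mulr0 addr0.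
- by rewrite inE => /eqP->; exists 1, 0; rewrite mulr1 add0r; split; [apply: ideal0|].
Qed.

Definition nonzerodivisor I z := forall g, I (z * g) -> I g.

(** Regularity in the form that recursion on the sequence produces: the head is
regular on [R/I] and the tail on [R/(I + head)]; properness is kept apart. *)
Fixpoint weakly_regular I s : Prop :=
  if s is z :: s' then nonzerodivisor I z /\ weakly_regular (add_gens I [:: z]) s'
  else True.

Lemma weakly_regularP I s : is_ideal I ->
  weakly_regular I s <-> forall i, (i < size s)%N ->
    nonzerodivisor (add_gens I (take i s)) s`_i.
Proof.
elim: s I => [|z s IHs] I iI //=; rewrite IHs; last exact: add_gens_ideal.
split=> [[zI sI] [_|i ilt]|zsI] /=; first by rewrite add_gens0.
  by rewrite -cat1s add_gens_cat; apply: sI.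
split=> [|i ilt]; first by have := zsI 0%N isT; rewrite /= add_gens0.
by have := zsI i.+1 ilt; rewrite /= -cat1s add_gens_cat.
Qed.

Lemma regular_seqP I s : is_ideal I ->
  regular_seq I s <-> weakly_regular I s /\ ~ add_gens I s 1.
Proof. by move=> iI; rewrite /regular_seq weakly_regularP. Qed.

Lemma weakly_regular_cat I s1 s2 : is_ideal I ->
  weakly_regular I (s1 ++ s2) <->
  weakly_regular I s1 /\ weakly_regular (add_gens I s1) s2.
Proof.
elim: s1 I => [|z s1 IHs] I iI /=; first by rewrite add_gens0; tauto.
rewrite IHs; last exact: add_gens_ideal.
by rewrite -add_gens_cat cat1s; tauto.
Qed.

Lemma weakly_regular_rcons I s z : is_ideal I ->
  weakly_regular I (rcons s z) <->
  weakly_regular I s /\ nonzerodivisor (add_gens I s) z.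
Proof. by move=> iI; rewrite -cats1 weakly_regular_cat //=; tauto. Qed.

Definition radical I : set R := [set z | exists a, I (z ^+ a)].

Lemma radical_ideal I : is_ideal I -> is_ideal (radical I).
Proof.
move=> iI; split=> [|x y [a Ix] [b Iy]|r x [a Ix]].
- by exists 1%N; rewrite expr1; apply: ideal0.
- exists (a + b)%N; rewrite exprDn; apply: ideal_sum => // i _.
  rewrite -mulr_natr; apply: idealMr => //.
  have [bi|ib] := leqP b i.
    by apply: idealMl => //; rewrite -(subnK bi) exprD; apply: idealMl.
  apply: idealMr => //.
  have := addnBAC a (ltnW ib); rewrite [(b + a)%N]addnC => <-.
  by rewrite exprD; apply: idealMl.
- by exists a; rewrite exprMn; apply: idealMl.
Qed.

Lemma sub_radical I : I `<=` radical I.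
Proof. by move=> z Iz; exists 1%N; rewrite expr1. Qed.

End Ideals.

(** * Koszul cochains *)

Section Koszul.
Variable R : comNzRingType.
Implicit Types (t : nat) (I J L G : set R) (s l : seq R) (w : R -> R) (c : seq R -> R).

(** Cochains are functions of finite sequences of ring elements, restricted to
sequences with entries in a generating set [G] of an ideal. No alternation is
imposed: for this larger Koszul-like complex, the homotopy that contracts
the multiplication by an element [p] of [G] is evaluation at the first argument
[p]. The weight [w] is the identity in the differential; other weights give
the operators that compare [G] to [G] with one element added. *)
Fixpoint koszul w c l : R :=
  if l is p :: l' then w p * c l' - koszul w (fun k => c (p :: k)) l' else 0.

Lemma eq_koszul w c c' l : c =1 c' -> koszul w c l = koszul w c' l.
Proof. by elim: l c c' => [|p l IHl] c c' cc' //=; rewrite cc' (IHl _ (fun k => c' (p :: k))). Qed.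

Lemma koszulB w c c' l :
  koszul w (fun k => c k - c' k) l = koszul w c l - koszul w c' l.
Proof.
elim: l c c' => [|p l IHl] c c' /=; first by rewrite subr0.
by rewrite IHl mulrBr; ring.
Qed.

Lemma koszulD w c c' l :
  koszul w (fun k => c k + c' k) l = koszul w c l + koszul w c' l.
Proof.
elim: l c c' => [|p l IHl] c c' /=; first by rewrite addr0.
by rewrite IHl mulrDr; ring.
Qed.

Lemma koszulN w c l : koszul w (fun k => - c k) l = - koszul w c l.
Proof.
elim: l c => [|p l IHl] c /=; first by rewrite oppr0.
by rewrite IHl; ring.
Qed.

Lemma koszulM w a c l : koszul w (fun k => a * c k) l = a * koszul w c l.
Proof.
elim: l c => [|p l IHl] c /=; first by rewrite mulr0.
by rewrite IHl; ring.
Qed.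

Lemma koszulDw w w' c l :
  koszul (fun p => w p + w' p) c l = koszul w c l + koszul w' c l.
Proof.
elim: l c => [|p l IHl] c /=; first by rewrite addr0.
by rewrite IHl; ring.
Qed.

Lemma koszulMw a w c l : koszul (fun p => a * w p) c l = a * koszul w c l.
Proof.
elim: l c => [|p l IHl] c /=; first by rewrite mulr0.
by rewrite IHl; ring.
Qed.

Lemma koszulK w c l : koszul w (koszul w c) l = 0.
Proof.
elim: l c => [|p l IHl] c //=.
rewrite koszulB koszulM IHl; ring.
Qed.

Lemma koszul_anticomm w w' c l :
  koszul w (koszul w' c) l = - koszul w' (koszul w c) l.
Proof.
elim: l c => [|p l IHl] c /=; first by rewrite oppr0.
by rewrite !koszulB !koszulM IHl; ring.
Qed.

Definition over G l := {in l, forall p, G p}.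

Lemma over_cons G p l : over G (p :: l) <-> G p /\ over G l.
Proof.
split=> [Gpl|[Gp Gl] q]; last by rewrite inE => /predU1P[->|/Gl].
by split=> [|q ql]; apply: Gpl; rewrite inE ?eqxx // ql orbT.
Qed.

Lemma koszul_in G J w c i : is_ideal J ->
  (forall l, over G l -> size l = i -> J (c l)) ->
  forall l, over G l -> size l = i.+1 -> J (koszul w c l).
Proof.
move=> iJ; elim: i c => [|i IHi] c Jc [|p l] //= /over_cons[Gp Gl] [sl].
  by case: l sl Gl => // _ Gl; rewrite /= subr0; apply: idealMl => //; apply: Jc.
apply: idealB => //; first by apply: idealMl => //; apply: Jc.
apply: IHi => // k Gk sk; apply: Jc; last by rewrite /= sk.
exact/over_cons.
Qed.

Definition cocycle G J i c :=
  forall l, over G l -> size l = i.+1 -> J (koszul id c l).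

(** For [J = L] this is the vanishing of the cohomology of [R/J] in degrees less
than [t]; a larger [L] makes room for what is lost when [G] shrinks. *)
Definition acyclic t G J L := forall i c, (i < t)%N -> cocycle G J i c ->
  exists g, forall l, over G l -> size l = i -> L (c l - koszul id g l).

(** The cohomology is annihilated by the ideal that [G] generates. *)
Lemma homotopy G J i c z : is_ideal J -> cocycle G J i c -> ideal_gen G z ->
  exists c', forall l, over G l -> size l = i -> J (z * c l - koszul id c' l).
Proof.
move=> iJ cJ.
pose H := [set z | exists c', forall l, over G l -> size l = i ->
             J (z * c l - koszul id c' l)].
suff HH : ideal_gen G `<=` H by move=> /HH.
apply: ideal_gen_sub => [|p Gp].
  split=> [|a b [ca Ja] [cb Jb]|r a [ca Ja]].
  - exists (fun=> 0) => l _ _.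
    rewrite (@eq_koszul _ _ (fun k => 0 * c k)); last by move=> k; rewrite mul0r.
    by rewrite koszulM !mul0r subr0; apply: ideal0.
  - exists (fun k => ca k + cb k) => l Gl sl.
    have := idealD iJ (Ja l Gl sl) (Jb l Gl sl).
    by rewrite koszulD; congr J; ring.
  - exists (fun k => r * ca k) => l Gl sl.
    have := idealMl r iJ (Ja l Gl sl).
    by rewrite koszulM; congr J; ring.
exists (fun k => c (p :: k)) => l Gl sl.
by apply: (cJ (p :: l)); rewrite ?over_cons //= sl.
Qed.

(** From the exact sequence [0 -> R/J -> R/J -> R/(J + fR) -> 0]: passing to the
quotient by a nonzerodivisor loses one degree. *)
Lemma acyclic_quotient t G J f : is_ideal J -> nonzerodivisor J f ->
  acyclic t.+1 G J J -> acyclic t G (add_gens J [:: f]) (add_gens J [:: f]).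
Proof.
move=> iJ fJ acJ i c iltt cJf.
have /choice[e eP] : forall l, exists e, over G l -> size l = i.+1 ->
    J (koszul id c l - f * e).
  move=> l; case: (pselect (over G l)) => [Gl|nGl]; last by exists 0.
  case: (eqVneq (size l) i.+1) => [sl|/eqP nsl]; last by exists 0.
  have /add_gens1P-/(_ iJ)[e [j [Jj eq]]] := cJf l Gl sl.
  by exists e => _ _; rewrite eq addrK.
have ecoc : cocycle G J i.+1 e.
  move=> l Gl sl; apply: fJ; rewrite -koszulM.
  rewrite (@eq_koszul _ _ (fun k => koszul id c k - (koszul id c k - f * e k)));
    last by move=> k; ring.
  rewrite koszulB koszulK sub0r; apply: idealN => //.
  by apply: (@koszul_in G J _ _ i.+1).
have [g gP] := acJ i.+1 e iltt ecoc.
have cgcoc : cocycle G J i (fun k => c k - f * g k).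
  move=> l Gl sl; rewrite koszulB koszulM.
  have := idealD iJ (eP l Gl sl) (idealMl f iJ (gP l Gl sl)).
  by congr J; ring.
have [k kP] := acJ i _ (leqW iltt) cgcoc.
exists k => l Gl sl; apply/add_gens1P => //.
by exists (g l), (c l - f * g l - koszul id k l); split; [apply: kP|ring].
Qed.

Lemma nonzerodivisorX J z a : nonzerodivisor J z -> nonzerodivisor J (z ^+ a).
Proof.
move=> zJ; elim: a => [|a IHa] g; first by rewrite expr0 mul1r.
by rewrite exprS -mulrA => /zJ/IHa.
Qed.

Lemma add_gens1_power J z a b : is_ideal J -> (a <= b)%N ->
  add_gens J [:: z ^+ b] `<=` add_gens J [:: z ^+ a].
Proof.
move=> iJ ab; apply: add_gens_sub; [exact: add_gens_ideal|exact: sub_add_gens|].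
move=> y; rewrite inE => /eqP->; rewrite -(subnK ab) exprD.
by apply: (idealMl _ (add_gens_ideal _ _)); apply: mem_add_gens; rewrite inE.
Qed.

(** Induction along [0 -> R/(J + zR) -> R/(J + z^(a+1)R) -> R/(J + z^a R) -> 0]. *)
Lemma acyclic_power t G J z a : is_ideal J -> nonzerodivisor J z ->
  acyclic t G (add_gens J [:: z]) (add_gens J [:: z]) ->
  acyclic t G (add_gens J [:: z ^+ a]) (add_gens J [:: z ^+ a]).
Proof.
move=> iJ zJ acz; elim: a => [|a IHa] i c iltt cJ.
  exists c => l _ _; rewrite -[X in add_gens _ _ X]mulr1.
  apply: (idealMl _ (add_gens_ideal _ _)).
  by apply: mem_add_gens; rewrite expr0 inE.
have iJS := add_gens_ideal J [:: z ^+ a.+1].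
have ca : cocycle G (add_gens J [:: z ^+ a]) i c.
  by move=> l Gl sl; apply: (add_gens1_power iJ (leqnSn a)); apply: cJ.
have [g gP] := IHa i c iltt ca.
have /choice[e eP] : forall l, exists e, over G l -> size l = i ->
    J (c l - koszul id g l - z ^+ a * e).
  move=> l; case: (pselect (over G l)) => [Gl|nGl]; last by exists 0.
  case: (eqVneq (size l) i) => [sl|/eqP nsl]; last by exists 0.
  have /add_gens1P-/(_ iJ)[e [j [Jj eq]]] := gP l Gl sl.
  by exists e => _ _; rewrite eq addrK.
have ecoc : cocycle G (add_gens J [:: z]) i e.
  move=> l Gl sl.
  have Jd := koszul_in id iJ eP Gl sl.
  have /add_gens1P-/(_ iJ)[r [j [Jj eq]]] := cJ l Gl sl.
  apply/add_gens1P => //; exists r, (koszul id e l - z * r); split; last by ring.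
  apply: (nonzerodivisorX (a := a) zJ).
  have := idealB iJ Jj Jd; rewrite !koszulB koszulK koszulM eq exprSr.
  by congr J; ring.
have [g' g'P] := acz i e iltt ecoc.
exists (fun k => g k + z ^+ a * g' k) => l Gl sl.
have /add_gens1P-/(_ iJ)[r [j [Jj eq]]] := g'P l Gl sl.
apply/add_gens1P => //.
exists r, ((c l - koszul id g l - z ^+ a * e l) + z ^+ a * j); split.
  by apply: idealD => //; [apply: eP|apply: idealMl].
rewrite koszulD koszulM.
have -> : e l = j + z * r + koszul id g' l by rewrite -eq subrK.
by rewrite exprSr; ring.
Qed.

(** A nonzerodivisor some power of which lies in the ideal generated by [G]
gains one degree, because the cohomology is annihilated by that power. *)
Lemma acyclic_extend t G J z : is_ideal J -> nonzerodivisor J z ->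
  radical (ideal_gen G) z ->
  acyclic t G (add_gens J [:: z]) (add_gens J [:: z]) ->
  acyclic t.+1 G J J.
Proof.
move=> iJ zJ [a Ga] /(acyclic_power (a := a) iJ zJ) acz i c iltt cJ.
have {}zJ := nonzerodivisorX (a := a) zJ.
have [c' c'P] := homotopy iJ cJ Ga.
case: i => [|i] in iltt cJ c'P *.
  exists c => l Gl sl; apply: zJ; rewrite mulrBr.
  by case: l Gl sl => // Gl sl; have := c'P [::] Gl sl; rewrite /= mulr0.
have c'coc : cocycle G (add_gens J [:: z ^+ a]) i c'.
  move=> l Gl sl; apply/add_gens1P => //.
  exists (c l), (koszul id c' l - z ^+ a * c l); split; last by ring.
  by have := idealN iJ (c'P l Gl sl); rewrite opprB.
have [g gP] := acz i c' iltt c'coc.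
have /choice[e eP] : forall l, exists e, over G l -> size l = i ->
    J (c' l - koszul id g l - z ^+ a * e).
  move=> l; case: (pselect (over G l)) => [Gl|nGl]; last by exists 0.
  case: (eqVneq (size l) i) => [sl|/eqP nsl]; last by exists 0.
  have /add_gens1P-/(_ iJ)[e [j [Jj eq]]] := gP l Gl sl.
  by exists e => _ _; rewrite eq addrK.
exists e => l Gl sl; apply: zJ.
have := koszul_in id iJ eP Gl sl; rewrite !koszulB koszulK koszulM => Jd.
have := idealD iJ (c'P l Gl sl) Jd.
by congr J; ring.
Qed.

Lemma acyclic_regular s G J : is_ideal J -> weakly_regular J s ->
  {in s, forall z, radical (ideal_gen G) z} -> acyclic (size s) G J J.
Proof.
elim: s J => [|z s IHs] J iJ //= [zJ sJ] sG.
apply: acyclic_extend zJ _ _ => //; first by apply: sG; rewrite inE eqxx.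
apply: IHs => //; first exact: add_gens_ideal.
by move=> y ys; apply: sG; rewrite inE ys orbT.
Qed.

Lemma acyclic_quotients s t G J : is_ideal J -> weakly_regular J s ->
  acyclic (size s + t) G J J -> acyclic t G (add_gens J s) (add_gens J s).
Proof.
elim: s J => [|f s IHs] J iJ /=; first by rewrite add_gens0.
move=> [fJ sJ] /(acyclic_quotient iJ fJ) acf.
rewrite -cat1s add_gens_cat; apply: IHs => //; exact: add_gens_ideal.
Qed.

(** Dropping a generator [x] loses one degree and enlarges [L] by [x]: the
shuffle product of a cocycle with the indicator of [x] is a cocycle on
[G] together with [x]; evaluating a primitive of it at sequences headed by [x]
gives the claim. *)
Lemma acyclic_drop t G J L x : is_ideal J ->
  acyclic t.+1 (G `|` [set x]) J L -> acyclic t G J (add_gens L [:: x]).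
Proof.
move=> iJ ac i c iltt cJ.
case: (pselect (G x)) => Gx.
  have GE : G `|` [set x] = G.
    by apply/seteqP; split=> [p [//|->]|p Gp] //; left.
  rewrite GE in ac; have [g gP] := ac i c (leqW iltt) cJ.
  by exists g => l Gl sl; apply: sub_add_gens; apply: gP.
(* [dx] is the shuffle product with the indicator of [x]; [c0] extends [c] by zero
   to sequences that contain [x]; [d0] is the part of the differential that
   ignores [x], so that the differential is [d0 + x dx], while [dx dx = 0]. *)
pose dx := koszul (fun p => (p == x)%:R).
pose c0 l := if x \in l then 0 else c l.
pose d0 := koszul (fun p => if p == x then 0 else p).
have dE b l : koszul id b l = d0 b l + x * dx b l.
  rewrite /d0 /dx -koszulMw -koszulDw; congr (koszul _ b l).
  by apply: funext => p; case: eqVneq => [->|_] /=; rewrite ?mulr1 ?mulr0 ?addr0 ?add0r.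
have dx0 b l : (forall k, b k = 0) -> dx b l = 0.
  move=> b0; rewrite /dx (@eq_koszul _ b (fun k => 0 * b k)); last first.
    by move=> k; rewrite b0 mul0r.
  by rewrite koszulM mul0r.
have d0x b l : (forall k, x \in k -> b k = 0) -> x \in l -> d0 b l = 0.
  rewrite /d0; elim: l b => [|p l IHl] b b0 //=; rewrite inE => xpl.
  have [pE|px] := eqVneq p x.
    rewrite mul0r sub0r (@eq_koszul _ _ (fun k => 0 * b k)); last first.
      by move=> k; rewrite mul0r b0 // pE inE eqxx.
    by rewrite koszulM mul0r oppr0.
  have xl : x \in l by case/predU1P: xpl px => // -> /eqP.
  rewrite b0 // mulr0 sub0r IHl ?oppr0 // => k xk.
  by rewrite b0 // inE xk orbT.
have d0n b b' l : (forall k, x \notin k -> b k = b' k) -> x \notin l ->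
    d0 b l = koszul id b' l.
  rewrite /d0; elim: l b b' => [|p l IHl] b b' bb' //=; rewrite inE negb_or eq_sym.
  move=> /andP[/negPf px xl]; rewrite px bb' //; congr (_ - _).
  by apply: IHl => // k xk; apply: bb'; rewrite inE negb_or eq_sym px.
have c0x k : x \in k -> c0 k = 0 by rewrite /c0 => ->.
have c0n k : x \notin k -> c0 k = c k by rewrite /c0 => /negPf->.
have Gn l : over G l -> x \notin l by move=> Gl; apply/negP => /Gl.
have nG l : over (G `|` [set x]) l -> x \notin l -> over G l.
  move=> Gl xl p pl; case: (Gl p pl) => // px; move: pl; rewrite px /=.
  by rewrite (negPf xl).
have Gc0 : cocycle (G `|` [set x]) J i.+1 (dx c0).
  move=> l Gl sl; rewrite /dx koszul_anticomm; apply: idealN => //.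
  rewrite (@eq_koszul _ _ (fun k => d0 c0 k + x * dx c0 k)); last exact: dE.
  rewrite koszulD koszulM koszulK mulr0 addr0.
  apply: (@koszul_in (G `|` [set x]) J _ _ i.+1) => // k Gk sk.
  have [xk|xk] := boolP (x \in k); first by rewrite d0x //; apply: ideal0.
  by rewrite (d0n _ c) //; apply: cJ => //; apply: nG.
have [g gP] := ac i.+1 (dx c0) iltt Gc0.
exists (fun k => - g (x :: k)) => l Gl sl.
have {gP} : L (dx c0 (x :: l) - koszul id g (x :: l)).
  apply: gP => /=; last by rewrite sl.
  by apply/over_cons; split=> [|p /Gl]; [right|left].
rewrite /dx /= eqxx mul1r -/dx dx0; last by move=> k; rewrite c0x // inE eqxx.
rewrite subr0 c0n ?Gn // koszulN opprK => Lc.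
rewrite -[X in add_gens _ _ X](subrK (x * g l)).
apply: (idealD (add_gens_ideal _ _)).
  apply: sub_add_gens; move: Lc; congr L; ring.
apply: (idealMr _ (add_gens_ideal _ _)).
by apply: mem_add_gens; rewrite inE.
Qed.

Lemma acyclic_drops xs t G J L : is_ideal J -> is_ideal L ->
  acyclic (size xs + t) (G `|` [set` xs]) J L ->
  acyclic t G J (add_gens L xs).
Proof.
elim: xs t G L => [|x xs IHxs] s G L iJ iL /=.
  have -> : G `|` [set` [::]] = G.
    by apply/seteqP; split=> [p [|//]|p Gp] //; left.
  by rewrite add_gens0.
have -> : G `|` [set` x :: xs] = (G `|` [set` xs]) `|` [set x].
  apply/seteqP; split=> p.
    by move=> [Gp|]; [left; left|rewrite /= inE => /predU1P[->|xsp]; [right|left; right]].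
  move=> [[Gp|/= xsp]|->]; [by left|by right; rewrite /= inE xsp orbT|].
  by right; rewrite /= inE eqxx.
move=> /(acyclic_drop iJ) acx.
rewrite -cat1s add_gens_cat; apply: IHxs => //; exact: add_gens_ideal.
Qed.

(** Ischebeck's inequality, in an elementary form. If [ys] is regular on [R/J],
cohomology vanishes below degree [size ys]; dividing out the regular sequence
[fs] and dropping the generators [xs] leaves degree [0], where a cocycle is an
element that [G] annihilates. *)
Theorem annihilated_by_few J ys fs xs G v : is_ideal J ->
  weakly_regular J ys -> weakly_regular J fs ->
  {in ys, forall y, radical (ideal_gen (G `|` [set` xs])) y} ->
  (size fs + size xs < size ys)%N ->
  (forall p, G p -> add_gens J fs (p * v)) ->
  add_gens (add_gens J fs) xs v.
Proof.
move=> iJ yJ fJ yG lt Gv.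
have iJf := add_gens_ideal J fs.
have := acyclic_regular iJ yJ yG.
rewrite -(subnKC lt) -addnS -addnA addSnnS => /(acyclic_quotients iJ fJ).
move=> acf; have ac := acyclic_drops iJf iJf acf.
have vcoc : cocycle G (add_gens J fs) 0 (fun=> v).
  move=> [|q [|//]] //= /over_cons[Gq _] _; rewrite subr0; exact: Gv.
have [g /(_ [::])] := ac 0%N (fun=> v) isT vcoc.
by rewrite /= subr0; apply.
Qed.

End Koszul.
(** * Monomial ideals and their associated primes *)

Section MonomialIdeals.
Variables (K : fieldType) (n : nat).
Implicit Types (U V : set 'X_{1..n}) (m w : 'X_{1..n}) (A : {set 'I_n}).
Implicit Types (f g : {mpoly K[n]}) (P : set {mpoly K[n]}).

Lemma addmCA : left_commutative (@mnm_add n).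
Proof. by move=> a b c; rewrite !addmA [(a + b)%MM]addmC. Qed.

Definition upset U := forall w m, U m -> U (w + m)%MM.

Lemma upset_le U m m' : upset U -> U m -> (m <= m')%MM -> U m'.
Proof. by move=> uU Um /submK <-; apply: uU. Qed.

(** A monomial ideal is handled through the set [U] of its monomials. *)
Definition mono_span U : set {mpoly K[n]} := [set f | {in msupp f, forall m, U m}].

Lemma mono_span_ideal U : upset U -> is_ideal (mono_span U).
Proof.
move=> uU; split=> [m|f g Uf Ug m|f g Ug m]; first by rewrite msupp0.
  by move/msuppD_le; rewrite mem_cat => /orP[/Uf|/Ug].
by move/msuppM_le => /allpairsP[[m1 m2] /= [_ /Ug Um ->]]; apply: uU.
Qed.

Lemma mono_spanX U m : mono_span U 'X_[m] <-> U m.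
Proof. by split=> [Um|Um w]; [apply: Um|]; rewrite msuppX inE // => /eqP->. Qed.

Lemma mono_spanMX U f w : mono_span U (f * 'X_[w]) <-> {in msupp f, forall m, U (w + m)%MM}.
Proof.
have E := perm_mem (msuppMX f w).
split=> Uf m; first by move=> fm; apply: Uf; rewrite E; apply: map_f.
by rewrite E => /mapP[m' fm' ->]; apply: Uf.
Qed.

(** Modulo the ideal, a polynomial may be replaced by its terms outside of it. *)
Lemma mono_span_split U f : exists g,
  mono_span U (f - g) /\ {in msupp g, forall m, m \in msupp f /\ ~ U m}.
Proof.
pose g := \sum_(m <- [seq m <- msupp f | ~~ `[< U m >]]) f@_m *: 'X_[m].
have gsub m : m \in msupp g -> m \in msupp f /\ ~ U m.
  move=> /msupp_sum_le; rewrite filter_predT => /flattenP[_ /mapP[m' + ->]].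
  rewrite mem_filter => /andP[/asboolPn nU fm'] /msuppZ_le.
  by rewrite msuppX inE => /eqP->.
exists g; split=> // m; rewrite mcoeff_msupp mcoeffB => nz.
apply: contrapT => nUm; move/eqP: nz; apply.
have [fm|/memN_msupp_eq0 fm] := boolP (m \in msupp f); last first.
  rewrite fm sub0r memN_msupp_eq0 ?oppr0 //; apply/negP => /gsub[].
  by rewrite mcoeff_msupp fm eqxx.
rewrite /g raddf_sum /= (bigD1_seq m) /=; last by rewrite filter_uniq ?msupp_uniq.
  rewrite mcoeffZ mcoeffX eqxx mulr1 big1 ?addr0 ?subrr // => m' nm.
  by rewrite mcoeffZ mcoeffX (negPf nm) mulr0.
by rewrite mem_filter fm andbT; apply/asboolPn.
Qed.

Lemma upset_gen (G : set 'X_{1..n}) : upset [set m | exists2 g, G g & (g <= m)%MM].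
Proof. by move=> w m [g Gg gm]; exists g => //; apply: lepm_trans gm (lem_addl _ _). Qed.

Lemma mono_span_gen (G : set 'X_{1..n}) :
  mono_ideal (K := K) G = mono_span [set m | exists2 g, G g & (g <= m)%MM].
Proof.
set U := [set m | _].
apply/seteqP; split.
  apply: ideal_gen_sub; first exact: mono_span_ideal (@upset_gen G).
  by move=> _ [m Gm <-]; apply/mono_spanX; exists m => //; apply: lepm_refl.
move=> f Uf; rewrite (mpolyE f) big_seq.
have iG : is_ideal (mono_ideal (K := K) G) by apply: ideal_gen_ideal.
apply: ideal_sum => // m /Uf[g Gg /submK <-].
rewrite -mul_mpolyC mpolyXD mulrA; apply: (idealMl _ iG).
by apply: sub_ideal_gen; exists g.
Qed.

Definition meets A m := exists2 i, i \in A & (0 < m i)%N.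

Lemma upset_meets A : upset (meets A).
Proof. by move=> w m [i iA mi]; exists i; rewrite // mnmDE addn_gt0 mi orbT. Qed.

Lemma meetsD A m w : meets A (m + w)%MM <-> meets A m \/ meets A w.
Proof.
split=> [[i iA]|[] [i iA mi]].
- by rewrite mnmDE addn_gt0 => /orP[|] wi; [left|right]; exists i.
- by exists i; rewrite // mnmDE addn_gt0 mi.
- by exists i; rewrite // mnmDE addn_gt0 mi orbT.
Qed.

Lemma meets0 A : ~ meets A 0%MM.
Proof. by case=> i _; rewrite mnm0E. Qed.

Lemma meets1 A i : meets A U_(i)%MM <-> i \in A.
Proof.
split=> [[j jA]|iA]; last by exists i; rewrite // mnm1E eqxx.
by rewrite mnm1E lt0b => /eqP->.
Qed.

Lemma meets_sum A (I : Type) (r : seq I) (F : I -> 'X_{1..n}) :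
  (forall i, ~ meets A (F i)) -> ~ meets A (\sum_(i <- r) F i)%MM.
Proof.
by move=> nF; apply: (big_ind (fun m => ~ meets A m)) => [|x y nx ny /meetsD[]|i _] //; apply: meets0.
Qed.

Definition mono_prime A : set {mpoly K[n]} := mono_span (meets A).

(** Two polynomials none of whose terms meets [A] have a product whose leading
term does not meet [A]. *)
Lemma mono_prime_prime A : is_prime (mono_prime A).
Proof.
have iA := mono_span_ideal (@upset_meets A).
split=> //; first by move=> /(_ 0%MM); rewrite msupp1 inE eqxx => /(_ isT)/meets0.
move=> f g Afg.
have [f' [Af ff']] := mono_span_split (meets A) f.
have [g' [Ag gg']] := mono_span_split (meets A) g.
case: (eqVneq f' 0) => [f0|f'0]; first by left; move: Af; rewrite f0 subr0.
case: (eqVneq g' 0) => [g0|g'0]; first by right; move: Ag; rewrite g0 subr0.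
have Afg' : mono_span (meets A) (f' * g').
  have := idealB iA (idealB iA Afg (idealMr g iA Af)) (idealMl f' iA Ag).
  by congr mono_span; ring.
have := Afg' (mlead (f' * g')); rewrite mlead_supp ?mulf_neq0 // => /(_ isT).
rewrite mleadM // => /meetsD[].
  by case: (ff' (mlead f')); rewrite ?mlead_supp.
by case: (gg' (mlead g')); rewrite ?mlead_supp.
Qed.

Lemma prime_monomial P m : is_prime P -> P 'X_[m] -> exists2 i, (0 < m i)%N & P 'X_i.
Proof.
move=> [iP P1 PM]; rewrite mpolyXE_id.
apply: (big_ind (fun x => P x -> exists2 i, (0 < m i)%N & P 'X_i)) => [/P1//|x y hx hy|i _].
  by move=> /PM[/hx|/hy].
have [->|mi] := posnP (m i); first by rewrite expr0 => /P1.
elim: {1}(m i) => [|k IHk]; first by rewrite expr0 => /P1.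
by rewrite exprS => /PM[Pi|/IHk//]; exists i.
Qed.

Definition prime_vars P : {set 'I_n} := finset (fun i => `[< P 'X_i >]).

Lemma mem_prime_vars P i : i \in prime_vars P <-> P 'X_i.
Proof. by rewrite /prime_vars finset.in_set; split=> /asboolP. Qed.

Lemma mono_prime_sub P A : is_ideal P -> (forall i, i \in A -> P 'X_i) ->
  mono_prime A `<=` P.
Proof.
move=> iP AP f Af; rewrite (mpolyE f) big_seq; apply: ideal_sum => // m /Af[i iA mi].
rewrite -mul_mpolyC; apply: idealMl => //.
have /submK <- : (U_(i) <= m)%MM by rewrite lep1mP -lt0n.
by rewrite mpolyXD; apply: idealMl => //; apply: AP.
Qed.

(** [mono_prime A] is the annihilator of the class of the monomial [m]. *)
Definition annihilates U m A := forall w, U (w + m)%MM <-> meets A w.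

Lemma annihilates_associated U m A : upset U -> annihilates U m A ->
  associated_prime (mono_span U) (mono_prime A).
Proof.
move=> uU UmA; split; first exact: mono_prime_prime.
exists 'X_[m]; apply/seteqP; split=> f.
  by move=> Af; apply/mono_spanMX => w /Af/UmA; rewrite addmC.
by move=> /mono_spanMX Uf w /Uf; rewrite addmC => /UmA.
Qed.

(** Write [P = J : f] with [f] having as few terms as possible. If [P] contained a
[g] whose terms avoid the variables in [P], the product of the leading terms of
[f] and [g] would lie in [J]; multiplying [f] by the leading monomial of [g], which
is not in [P], and dropping this leading term would leave [P = J : f'] with fewer
terms. So [P] is generated by variables; these kill all the terms of [f], and one of
the terms is killed by no monomial outside of [P], as otherwise a product of such
monomials would kill [f]. *)
Lemma associated_mono_prime U P : upset U -> associated_prime (mono_span U) P ->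
  exists A m, P = mono_prime A /\ annihilates U m A.
Proof.
move=> uU [prP [f0 Pf0]].
have iU := mono_span_ideal uU; have iP : is_ideal P by case: prP.
pose A := prime_vars P.
have AP : mono_prime A `<=` P by apply: mono_prime_sub => // i /mem_prime_vars.
have exN : exists N, `[< exists f, P = [set g | mono_span U (g * f)] /\ size (msupp f) = N >].
  by exists (size (msupp f0)); apply/asboolP; exists f0.
have [N /asboolP[f1 [Pf1 szf1]] minN] := ex_minnP exN.
have [f [Uf1f ff1]] := mono_span_split U f1.
have Pf : P = [set g | mono_span U (g * f)].
  rewrite Pf1; apply/seteqP; split=> g Ug.
    by have := idealB iU Ug (idealMl g iU Uf1f); congr mono_span; ring.
  by have := idealD iU Ug (idealMl g iU Uf1f); congr mono_span; ring.
have minf f' : P = [set g | mono_span U (g * f')] -> (size (msupp f) <= size (msupp f'))%N.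
  move=> Pf'; apply: (@leq_trans (size (msupp f1))); last first.
    by rewrite szf1; apply: minN; apply/asboolP; exists f'.
  by apply: uniq_leq_size => [|m /ff1[]]; rewrite ?msupp_uniq.
have P1 : ~ P 1 by case: prP.
have f_neq0 : f != 0.
  by apply/eqP => fz; apply: P1; rewrite Pf /= fz mulr0; apply: (ideal0 iU).
have Afree w : ~ meets A w -> ~ P 'X_[w].
  move=> nAw /(prime_monomial prP)[i wi /mem_prime_vars iA]; apply: nAw.
  by exists i.
have PA : P `<=` mono_prime A.
  move=> g Pg; have [g' [Agg' gg']] := mono_span_split (meets A) g.
  case: (eqVneq g' 0) => [g0|g'0]; first by move: Agg'; rewrite g0 subr0.
  have Pg' : P g'.
    by have := idealB iP Pg (AP _ Agg'); rewrite subKr.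
  pose a := mlead g'; pose m := mlead f.
  have Uam : U (a + m)%MM.
    move: Pg'; rewrite Pf /= => Ug'f; apply: Ug'f.
    by rewrite -mleadM // mlead_supp // mulf_neq0.
  have nPa : ~ P 'X_[a] by apply: Afree; case: (gg' a); rewrite ?mlead_supp.
  pose h := f - f@_m *: 'X_[m].
  have szh : (size (msupp h) < size (msupp f))%N.
    have fm : m \in msupp f by apply: mlead_supp.
    by rewrite (perm_size (msupp_rem f m)) size_rem // ltn_predL; case: (msupp f) fm.
  suff /minf : P = [set k | mono_span U (k * (h * 'X_[a]))].
    have -> : size (msupp (h * 'X_[a])) = size (msupp h).
      by rewrite (perm_size (msuppMX h a)) size_map.
    by rewrite leqNgt szh.
  have hf k : mono_span U (k * (h * 'X_[a])) <-> mono_span U (k * (f * 'X_[a])).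
    have Uk : mono_span U (k * (f@_m *: 'X_[m + a])).
      rewrite -mul_mpolyC; do 2 apply: (idealMl _ iU).
      by apply/mono_spanX; rewrite addmC.
    rewrite /h mulrBl -scalerAl -mpolyXD mulrBr; split=> Uh; last exact: (idealB iU Uh Uk).
    by rewrite -[X in mono_span _ X](subrK (k * (f@_m *: 'X_[m + a]))); apply: (idealD iU).
  apply/seteqP; split=> k.
    by move=> Pk; apply/hf; rewrite mulrA; apply: (idealMr _ iU); move: Pk; rewrite {1}Pf.
  move=> /hf Uk; have : P (k * 'X_[a]) by rewrite Pf /= -mulrA ['X_[a] * f]mulrC.
  by case: prP => _ _ PM /PM[|/nPa].
have PE : P = mono_prime A by apply/seteqP.
have mA m : m \in msupp f -> forall w, meets A w -> U (w + m)%MM.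
  move=> fm w Aw; have : P 'X_[w] by rewrite PE; apply/mono_spanX.
  by rewrite {1}Pf /= mulrC => /mono_spanMX; apply.
suff [m fm Am] : exists2 m, m \in msupp f & forall w, U (w + m)%MM -> meets A w.
  by exists A, m; split=> // w; split; [apply: Am|apply: mA].
apply: contrapT => /forall2NP nm.
have /choice[w wP] : forall m, exists w, m \in msupp f -> U (w + m)%MM /\ ~ meets A w.
  move=> m; case: (nm m) => [/negP fm|/existsNP[w /not_implyP wP]]; last by exists w.
  by exists 0%MM => /(negP fm).
pose W := (\sum_(m <- msupp f) (if m \in msupp f then w m else 0))%MM.
have : ~ meets A W.
  apply: meets_sum => m; case: ifP => [/wP[]//|_]; exact: meets0.
move=> /Afree; apply; rewrite Pf /= mulrC; apply/mono_spanMX => m fm.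
have [Uw _] := wP m fm; rewrite /W (bigD1_seq m) ?msupp_uniq //= fm.
by rewrite addmC addmA addmC; apply: uU; rewrite addmC.
Qed.

(** A monomial outside of [U] that is killed by a largest set [A] of variables has
a prime annihilator: if [w] kills it without meeting [A], dividing [w] by its
variables one by one shows that a multiple is killed by a further variable. *)
Lemma exists_annihilates U m (A0 : {set 'I_n}) : upset U -> ~ U m ->
  (forall i, i \in A0 -> U (U_(i) + m)%MM) ->
  exists A m', A0 \subset A /\ annihilates U m' A.
Proof.
move=> uU nUm A0m.
pose Q k := `[< exists A m', [/\ #|A| = k, A0 \subset A, ~ U m' &
                forall i, i \in A -> U (U_(i) + m')%MM] >].
have exQ : exists k, Q k by exists #|A0|; apply/asboolP; exists A0, m.
have ubQ k : Q k -> (k <= n)%N.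
  by move=> /asboolP[A [_ [<- _ _ _]]]; rewrite -[X in (_ <= X)%N]card_ord max_card.
have [k /asboolP[A [m' [cA A0A nUm' Am']]] maxk] := ex_maxnP exQ ubQ.
exists A, m'; split=> // w; split; last first.
  move=> [i iA wi]; have : (U_(i) <= w)%MM by rewrite lep1mP -lt0n.
  by move/submK <-; rewrite -addmA; apply: uU; apply: Am'.
have [d] := ubnP (mdeg w); elim: d w => // d IHd w dw Uw.
apply: contrapT => nAw.
have [/eqP|/eqP wn0] := eqVneq w 0%MM; first by move=> /eqP w0; move: Uw; rewrite w0 add0m.
have [i wi] : exists i, (0 < w i)%N.
  apply: contrapT => /forallNP w0; apply: wn0; apply/mnmP => i.
  by have /negP := w0 i; rewrite -eqn0Ngt mnm0E => /eqP.
have iA : i \notin A by apply/negP => iA; apply: nAw; exists i.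
have wE : w = (U_(i) + (w - U_(i)))%MM by rewrite addmC submK // lep1mP -lt0n.
pose w' := (w - U_(i))%MM; rewrite -/w' in wE.
have nUw' : ~ U (w' + m')%MM.
  move=> /IHd /=; have := dw; rewrite {1}wE mdegD mdeg1 ltnS add1n => /[swap]/[apply].
  by move=> Aw'; apply: nAw; rewrite wE; apply/meetsD; right.
have : Q k.+1.
  apply/asboolP; exists (i |: A), (w' + m')%MM; split=> //.
  - by rewrite cardsU1 iA cA.
  - by apply: fintype.subset_trans A0A _; apply: finset.subsetU1.
  - move=> j; rewrite finset.in_setU1 => /predU1P[->|jA]; first by rewrite addmA -wE.
    rewrite [(w' + _)%MM]addmC addmA [X in U X]addmC; apply: uU; exact: Am'.
by move=> /maxk; rewrite ltnn.
Qed.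

(** After inverting the variables outside of [A'], the ideal is still proper and no
inverted variable lies in an associated prime; a common denominator brings the
annihilated monomial back. *)
Lemma exists_annihilates_sub U (A' : {set 'I_n}) : upset U -> U `<=` meets A' ->
  exists A m, A \subset A' /\ annihilates U m A.
Proof.
move=> uU UA'.
pose V : set 'X_{1..n} := [set m | exists2 w, ~ meets A' w & U (w + m)%MM].
have uV : upset V.
  by move=> w m [w' nw' Uw']; exists w' => //; rewrite addmCA; apply: uU.
have nV0 : ~ V 0%MM by case=> w nw; rewrite addm0 => /UA'.
have V0 i : i \in finset.set0 -> V (U_(i) + 0)%MM by rewrite finset.in_set0.
have [A [m [_ VmA]]] := exists_annihilates uV nV0 V0.
have AA' : A \subset A'.
  apply/fintype.subsetP => i iA; apply: contrapT => /negP niA'.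
  have [w nw] : V (U_(i) + m)%MM by apply/VmA/meets1.
  rewrite addmA => Um; apply: (@meets0 A); apply/VmA; rewrite add0m.
  by exists (w + U_(i))%MM => // /meetsD[//|/meets1]; apply/negP.
have /choice[w wP] : forall i, exists w, i \in A -> ~ meets A' w /\ U (w + (U_(i) + m))%MM.
  move=> i; have [iA|niA] := boolP (i \in A); last by exists 0%MM.
  by have [w nw Uw] : V (U_(i) + m)%MM; [apply/VmA/meets1|exists w].
pose W := (\sum_(i <- enum 'I_n) (if i \in A then w i else 0))%MM.
have nW : ~ meets A' W.
  apply: meets_sum => i; case: ifP => [/wP[]//|_]; exact: meets0.
exists A, (W + m)%MM; split=> // v; split.
  rewrite addmCA => Uv; apply/VmA; by exists W.
case=> i iA vi; have [_ Uw] := wP i iA; apply: upset_le Uw _ => //.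
rewrite /W (bigD1_seq i) ?mem_enum ?enum_uniq //= iA.
apply/mnm_lepP => k; rewrite !mnmDE.
have : (U_(i)%MM k <= v k)%N by rewrite mnm1E; case: eqVneq => // <-.
by lia.
Qed.

Lemma annihilates_notin U m A : annihilates U m A -> ~ U m.
Proof. by move=> UmA; rewrite -[m]add0m => /UmA/meets0. Qed.

(** Outside of the ideal, terms of [('X_a - 'X_b) * g] must cancel. *)
Lemma diff_cancel U a b g m : mono_span U (('X_a - 'X_b) * g) ->
  m \in msupp g -> ~ U (U_(a) + m)%MM ->
  exists2 m', m' \in msupp g & (U_(a) + m = U_(b) + m')%MM.
Proof.
move=> Ug gm nU; have : (('X_a - 'X_b) * g)@_(U_(a) + m) = 0.
  by apply: memN_msupp_eq0; apply/negP => /Ug.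
rewrite mulrBl mcoeffB ![_ * g]mulrC mcoeffMX => /eqP; rewrite subr_eq0 => /eqP gE.
have : (U_(a) + m)%MM \in msupp (g * 'X_b) by rewrite mcoeff_msupp -gE -mcoeff_msupp.
by rewrite (perm_mem (msuppMX _ _)) => /mapP[m' gm' E]; exists m'.
Qed.

(** A zerodivisor [x_i - x_j] yields a monomial outside of [U] that both
variables kill. Among the terms of [g] outside of [U], one with the
largest exponent in [x_i] is killed by [x_i], since a cancelling term would have a
larger exponent. If no power of [x_j] killed it, cancellation would replace
[x_i] by [x_j] in this term forever. *)
Lemma nonzerodivisor_diff U i j : upset U -> i != j ->
  (forall m, U (U_(i) + m)%MM -> U (U_(j) + m)%MM -> U m) ->
  nonzerodivisor (mono_span U) ('X_i - 'X_j).
Proof.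
move=> uU ij Uij g Ug m gm; apply: contrapT => nUm.
have Ug' : mono_span U (('X_j - 'X_i) * g).
  by rewrite -opprB mulNr; apply: (idealN (mono_span_ideal uU)).
have [M [[gM nUM] maxM]] : exists M, (M \in msupp g /\ ~ U M) /\
    forall m', m' \in msupp g -> ~ U m' -> (m' i <= M i)%N.
  pose Q k := `[< exists m', [/\ m' \in msupp g, ~ U m' & m' i = k] >].
  have exQ : exists k, Q k by exists (m i); apply/asboolP; exists m.
  have ubQ k : Q k -> (k <= msize g)%N.
    move=> /asboolP[m' [gm' _ <-]]; apply: ltnW.
    apply: leq_ltn_trans (msize_mdeg_lt gm').
    by rewrite mdegE (bigD1 i) //= leq_addr.
  have [k /asboolP[M [gM nUM kM]] maxk] := ex_maxnP exQ ubQ.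
  exists M; split=> // m' gm' nUm'; rewrite kM; apply: maxk; apply/asboolP.
  by exists m'.
have UiM : U (U_(i) + M)%MM.
  apply: contrapT => nUp; have [m' gm' E] := diff_cancel Ug gM nUp.
  have nUm' : ~ U m' by move=> Um'; apply: nUp; rewrite E; apply: uU.
  have := maxM m' gm' nUm'; have := congr1 (fun w : 'X_{1..n} => w i) E.
  by rewrite !mnmDE !mnm1E eqxx [j == i]eq_sym (negPf ij); lia.
have UjM : forall t, ~ U (U_(j) *+ t + M)%MM.
  elim=> [|t IHt]; first by rewrite mulm0n add0m.
  move=> UtM; apply: IHt; apply: Uij; last by rewrite addmA -mulmS.
  by rewrite addmCA; apply: uU.
have walk s : (s <= M i)%N /\
    (M + U_(j) *+ s - U_(i) *+ s)%MM \in msupp g.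
  elim: s => [|s [sM gs]]; first by rewrite !mulm0n addm0 subm0.
  have nUp : ~ U (U_(j) + (M + U_(j) *+ s - U_(i) *+ s))%MM.
    move=> Up; apply: (UjM s.+1); apply: upset_le Up _ => //.
    by apply/mnm_lepP => k; rewrite !(mnmDE, mnmBE, mulmnE, mnm1E); lia.
  have [m' gm' E] := diff_cancel Ug' gs nUp.
  have Ek k : ((k == j) + (M k + (k == j) * s - (k == i) * s) = (k == i) + m' k)%N.
    have := congr1 (fun w : 'X_{1..n} => w k) E.
    by rewrite /= !(mnmDE, mnmBE, mulmnE, mnm1E) ![_ == k]eq_sym.
  split; first by have := Ek i; rewrite eqxx (negPf ij); lia.
  suff <- : m' = (M + U_(j) *+ s.+1 - U_(i) *+ s.+1)%MM by [].
  apply/mnmP => k; have := Ek k.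
  rewrite !(mnmDE, mnmBE, mulmnE, mnm1E) ![_ == k]eq_sym.
  by case: (eqVneq k i) => [->|_]; case: eqVneq => _; lia.
by have [] := walk (M i).+1; rewrite ltnn.
Qed.

End MonomialIdeals.
(** * Chains of prime ideals *)

Section Dimension.
Variables (K : fieldType) (n : nat).
Implicit Types (P : set {mpoly K[n]}) (c : nat -> set {mpoly K[n]}).
Implicit Types (A : {set 'I_n}).

Definition deg_le d (p : {mpoly K[n]}) := {in msupp p, forall m, (mdeg m <= d)%N}.

Lemma deg_leM d e (p q : {mpoly K[n]}) :
  deg_le d p -> deg_le e q -> deg_le (d + e) (p * q).
Proof.
move=> dp eq m /msuppM_le/allpairsP[[m1 m2] /= [/dp d1 /eq d2 ->]].
by rewrite mdegD leq_add.
Qed.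

Lemma deg_le_monomial N E (x : 'I_n.+1 -> {mpoly K[n]}) (a : 'I_n.+1 -> 'I_N) :
  (forall i, deg_le E (x i)) -> deg_le (n.+1 * (N.-1 * E)) (\prod_i x i ^+ a i).
Proof.
move=> xE; have le1 : deg_le 0 1 by move=> m; rewrite msupp1 inE => /eqP->; rewrite mdeg0.
have xaE i : deg_le (a i * E) (x i ^+ a i).
  elim: (nat_of_ord (a i)) => [|k IHk]; first by rewrite expr0 mul0n.
  by rewrite exprS mulSn; apply: deg_leM.
have : deg_le (\sum_i a i * E) (\prod_i x i ^+ a i).
  by elim/big_ind2: _ => // [p d q e]; apply: deg_leM.
move=> H m /H /leq_trans; apply.
rewrite -[X in (X * _)%N]card_ord -sum_nat_const; apply: leq_sum => i _.
by rewrite leq_mul2r; apply/orP; right; have := ltn_ord (a i); lia.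
Qed.

(** There are [N ^ n.+1] monomials in the [x i] with exponents below [N], but
only [(C * N) ^ n] monomials that can occur in them. *)
Lemma algebraic_dependence (x : 'I_n.+1 -> {mpoly K[n]}) :
  exists N (lam : {ffun 'I_n.+1 -> 'I_N} -> K),
    (exists a, lam a != 0) /\ \sum_a lam a *: (\prod_i x i ^+ a i) = 0.
Proof.
pose E := \max_i msize (x i).
have xE i : deg_le E (x i).
  move=> m /msize_mdeg_lt /ltnW /leq_trans; apply.
  exact: (leq_bigmax (F := fun i => msize (x i))).
pose C := (n.+1 * E.+1)%N; pose N := (C ^ n).+1.
pose T1 := {ffun 'I_n.+1 -> 'I_N}; pose T2 := {ffun 'I_n -> 'I_(C * N)}.
have cT : (#|T2| < #|T1|)%N.
  rewrite !card_ffun !card_ord expnMn expnS ltn_pmul2r ?expn_gt0 //.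
pose mon (b : T2) : 'X_{1..n} := [multinom (b k : nat) | k < n].
pose prd (a : T1) := \prod_i x i ^+ a i.
pose M := \matrix_(i < #|T1|, j < #|T2|) (prd (enum_val i))@_(mon (enum_val j)).
have : kermx M != 0.
  rewrite kermx_eq0 /row_free neq_ltn (leq_ltn_trans (rank_leq_col M)) //.
case/matrix0Pn => i0 [j0 nz].
exists N, (fun a => kermx M i0 (enum_rank a)); split.
  by exists (enum_val j0); rewrite enum_valK.
apply/mpolyP => m; rewrite raddf_sum mcoeff0 /=.
have [small|big] := boolP [forall k, (m k < C * N)%N]; last first.
  apply: big1 => a _; rewrite mcoeffZ [X in _ * X]memN_msupp_eq0 ?mulr0 //.
  apply/negP => /(deg_le_monomial xE) mle; move/forallPn: big => [k]; rewrite -leqNgt.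
  have km : (m k <= mdeg m)%N by rewrite mdegE (bigD1 k) //= leq_addr.
  move=> /leq_trans-/(_ _ km) /leq_trans-/(_ _ mle).
  by rewrite /C -mulnA leq_pmul2l // mulnC leqNgt ltn_mul // /N.
pose b : T2 := [ffun k => Ordinal (forallP small k)].
have mb : mon b = m by apply/mnmP => k; rewrite mnmE ffunE.
have /matrixP/(_ i0 (enum_rank b)) := mulmx_ker M.
rewrite mxE [X in _ = X]mxE => kerE; rewrite -[RHS]kerE.
rewrite [RHS](reindex_onto (@enum_rank T1) enum_val) /=; last by move=> j _; rewrite enum_valK.
apply: eq_big => [a|a _]; first by rewrite enum_rankK eqxx.
by rewrite mcoeffZ [M _ _]mxE !enum_rankK mb.
Qed.

(** Elements [x i] of [c i.+1] outside of [c i] satisfy no polynomial relation: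
the terms of a relation with least exponent in [x k], divided by a power of
[x k], form a relation modulo [c k.+1] among the later elements. *)
Lemma prime_chain_bound c d : prime_chain c d -> (d <= n)%N.
Proof.
move=> [cP cS]; rewrite leqNgt; apply/negP => ltnd.
have ci (i : 'I_n.+1) : (i < d)%N by apply: leq_trans ltnd.
have /choice[x xP] : forall i : 'I_n.+1, exists x, c i.+1 x /\ ~ c i x.
  move=> i; have [_ /existsNP[y /not_implyP[y1 y2]]] := cS i (ci i).
  by exists y.
have [N [lam [[a0 a0P] rel]]] := algebraic_dependence x.
pose T := {ffun 'I_n.+1 -> 'I_N}.
pose tl k (a : T) := \prod_(i < n.+1 | (k <= i)%N) x i ^+ a i.
have inv : forall k, (k <= n.+1)%N -> exists S : {set T},
    [/\ exists a, a \in S, forall a, a \in S -> lam a != 0,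
        forall a b, a \in S -> b \in S -> forall i : 'I_n.+1, (i < k)%N -> a i = b i
      & c k (\sum_(a in S) lam a *: tl k a)].
  elim=> [_|k IHk ltk].
    exists (finset (fun a => lam a != 0)); split=> //.
    - by exists a0; rewrite finset.in_set.
    - by move=> a; rewrite finset.in_set.
    rewrite (_ : \sum_(a in _) _ = 0); first by apply: ideal0; case: (cP 0%N isT).
    rewrite -[RHS]rel [RHS](bigID (fun a => lam a != 0)) /= [X in _ + X]big1 ?addr0.
      by apply: eq_big => [a|a _]; rewrite ?finset.in_set.
    by move=> a /negPn/eqP->; rewrite scale0r.
  have [S [[a1 a1S] Slam Seq Sc]] := IHk (ltnW ltk).
  pose k' := Ordinal ltk; pose y := x k'.
  have [am amS amin] : exists2 am, am \in S & forall a, a \in S -> (am k' <= a k')%N.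
    by case: (arg_minnP (fun a : T => a k' : nat) a1S) => am; exists am.
  pose e := am k'; pose S' := finset (fun a : T => (a \in S) && (a k' == e)).
  have tlE a : tl k a = y ^+ a k' * tl k.+1 a.
    rewrite /tl (bigD1 k') //=; congr (_ * _); apply: eq_bigl => i.
    by rewrite ltn_neqAle andbC eq_sym.
  pose rest := \sum_(a in S | a k' != e) lam a *: (y ^+ (a k' - e).-1 * tl k.+1 a).
  have sumE : \sum_(a in S) lam a *: tl k a
      = y ^+ e * (\sum_(a in S') lam a *: tl k.+1 a + y * rest).
    rewrite (bigID (fun a : T => a k' == e)) /= mulrDr; congr (_ + _).
      rewrite mulr_sumr; apply: eq_big => [a|a /andP[aS /eqP ae]].
        by rewrite finset.in_set.
      by rewrite tlE ae scalerAr.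
    rewrite mulrA -exprSr /rest mulr_sumr; apply: eq_bigr => a /andP[aS ae].
    rewrite tlE -scalerAr; congr (_ *: _); rewrite mulrA -exprD.
    congr (_ ^+ _ * _); have := amin a aS; move: ae; rewrite -val_eqE /= -/e.
    by lia.
  have [ick ck1 ckM] := cP k (ltnW (ci k')).
  have [ick1 _ _] := cP k.+1 (ci k').
  have [y1 y0] := xP k'.
  have cb : c k (\sum_(a in S') lam a *: tl k.+1 a + y * rest).
    have yN t g : c k (y ^+ t * g) -> c k g.
      by elim: t => [|t IHt]; rewrite ?expr0 ?mul1r // exprS -mulrA => /ckM[].
    by apply: (yN e); rewrite -sumE.
  exists S'; split.
  - by exists am; rewrite finset.in_set amS eqxx.
  - by move=> a; rewrite finset.in_set => /andP[/Slam].
  - move=> a b; rewrite !finset.in_set => /andP[aS /eqP ae] /andP[bS /eqP be] i.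
    rewrite ltnS leq_eqVlt => /orP[/eqP ik|]; last exact: Seq.
    have -> : i = k' by apply: val_inj.
    by rewrite ae be.
  rewrite -[X in c _ X](addrK (y * rest)); apply: idealB => //.
    by have [ckS _] := cS k (ci k'); apply: ckS.
  exact: idealMr.
have [S [[a aS] Slam Seq Sc]] := inv n.+1 (leqnn _).
have Sa : {in S, forall b, b = a}.
  by move=> b bS; apply/ffunP => i; apply: Seq.
move: Sc; rewrite (big_pred1 a) => [|b]; last first.
  by apply/idP/eqP => [/Sa|->].
rewrite /tl big1 => [|i]; last by rewrite leqNgt ltn_ord.
have [ic c1 _] := cP n.+1 ltnd.
move=> /(idealMl (lam a)^-1%:MP ic).
by rewrite mul_mpolyC scalerA mulVf ?Slam // scale1r.
Qed.

(** If the end of one chain lies in the start of another, the two concatenate;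
the end of the first is dropped, since the inclusion need not be strict. *)
Lemma prime_chain_glue c c' d d' : prime_chain c d -> prime_chain c' d' ->
  c d `<=` c' 0%N -> prime_chain (fun i => if (i < d)%N then c i else c' (i - d)%N) (d + d').
Proof.
move=> [cP cS] [cP' cS'] cc'; split=> i ilt.
  by case: ltnP => di; [apply: cP; apply: ltnW|apply: cP'; lia].
have [di|di|di] := ltngtP i.+1 d.
- by apply: cS; apply: ltnW.
- by rewrite subSn //; apply: cS'; lia.
- rewrite di subnn; have [|sub nsub] := cS i; first by rewrite di.
  rewrite -di in cc'; split; first exact: subset_trans cc'.
  by move=> c'c; apply: nsub; apply: subset_trans c'c.
Qed.

Lemma mono_prime_chain A A' : A \subset A' -> exists c,
  [/\ prime_chain c (#|A'| - #|A|), c 0%N = mono_prime A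
    & c (#|A'| - #|A|)%N = mono_prime A'].
Proof.
move=> AA'; pose s := enum (A' :\: A)%SET.
have ss : size s = (#|A'| - #|A|)%N by rewrite -cardE cardsDS.
pose B k := finset (fun i => (i \in A) || (i \in take k s)).
exists (fun k => mono_prime (B k)); split; first split=> i ilt.
- exact: mono_prime_prime.
- have si : (i < size s)%N by rewrite ss.
  have [x0] : exists x0 : 'I_n, True by case: s si {ss B} => // x0; exists x0.
  move=> _; split=> [f Bf m /Bf[j jB mj]|/(_ 'X_(nth x0 s i))].
    exists j => //; move: jB; rewrite !finset.in_set (take_nth x0 si) mem_rcons inE.
    by case/orP=> ->; rewrite ?orbT.
  have : mono_span (meets (B i.+1)) ('X_(nth x0 s i) : {mpoly K[n]}).
    by apply/mono_spanX/meets1; rewrite finset.in_set (take_nth x0 si) mem_rcons inE eqxx orbT.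
  move=> h /(_ h)/mono_spanX/meets1; rewrite finset.in_set => /orP[iA|it].
    by have := mem_nth x0 si; rewrite mem_enum inE iA.
  have := enum_uniq (A' :\: A)%SET; rewrite -/s -(cat_take_drop i s) cat_uniq.
  case/and3P => _ /hasPn /(_ (nth x0 s i)); rewrite it => + _.
  by rewrite (drop_nth x0 si) inE eqxx => /(_ isT).
- by congr mono_prime; apply/setP => i; rewrite finset.in_set take0 in_nil orbF.
- congr mono_prime; apply/setP => i.
  rewrite finset.in_set -ss take_size mem_enum inE.
  by have /fintype.subsetP/(_ i) := AA'; case: (i \in A) => //= ->.
Qed.

(** A chain ending at the prime on [A] continues through the remaining variables,
so its length is bounded by the bound for all chains. *)
Lemma mono_prime_height A : prime_height (mono_prime A : set {mpoly K[n]}) #|A|.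
Proof.
split.
  have [c [cc _ cA]] := mono_prime_chain (finset.sub0set A).
  by rewrite cards0 subn0 in cc cA; exists c.
move=> c d cc cd.
have [c' [cc' c'0 _]] := mono_prime_chain (finset.subsetT A).
have := prime_chain_bound (prime_chain_glue cc cc' _).
rewrite cd c'0 => /(_ (@subset_refl _ _)); rewrite cardsT card_ord.
by have := max_card A; rewrite card_ord; lia.
Qed.

Lemma prime_height_uniq P h h' : prime_height P h -> prime_height P h' -> h = h'.
Proof.
move=> [[c [cc cP]] ub] [[c' [cc' cP']] ub']; apply/eqP.
by rewrite eqn_leq (ub' _ _ cc cP) (ub _ _ cc' cP').
Qed.

Lemma prime_vars_card P h : is_prime P -> prime_height P h -> (#|prime_vars P| <= h)%N.
Proof.
move=> prP [_ ub]; have iP : is_ideal P by case: prP.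
have [c [cc _ cA]] := mono_prime_chain (finset.sub0set (prime_vars P)).
rewrite cards0 subn0 in cc cA.
have cP : prime_chain (fun=> P) 0 by split=> // i; rewrite ltn0.
have := prime_chain_glue cc cP; rewrite cA addn0.
have sP : mono_prime (prime_vars P) `<=` P.
  by apply: mono_prime_sub => // i /mem_prime_vars.
by move=> /(_ sP)/ub; apply; rewrite ltnn.
Qed.

(** A chain above [J] can be preceded by a chain of monomial primes that ends at the
prime on the variables in its first term. *)
Lemma mono_quot_dim (J : set {mpoly K[n]}) A :
  J `<=` mono_prime A ->
  (forall P, is_prime P -> J `<=` P -> (#|A| <= #|prime_vars P|)%N) ->
  quot_dim J (n - #|A|).
Proof.
move=> JA minA; split.
  have [c [cc c0 _]] := mono_prime_chain (finset.subsetT A).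
  by rewrite cardsT card_ord in cc; exists c; rewrite c0.
move=> c k cc Jc; have prc : is_prime (c 0%N) by case: cc => + _; apply.
have ic : is_ideal (c 0%N) by case: prc.
have [c' [cc' _ c'A]] := mono_prime_chain (finset.sub0set (prime_vars (c 0%N))).
rewrite cards0 subn0 in cc' c'A.
have := prime_chain_bound (prime_chain_glue cc' cc _).
rewrite c'A => H; have {}H := H (mono_prime_sub ic _); rewrite leq_subRL.
  apply: leq_trans (H _); last by move=> i /mem_prime_vars.
  by rewrite leq_add2r minA.
by rewrite -[X in (_ <= X)%N]card_ord max_card.
Qed.

Lemma quot_dim_uniq (J : set {mpoly K[n]}) d d' : quot_dim J d -> quot_dim J d' -> d = d'.
Proof.
move=> [[c [cc cJ]] ub] [[c' [cc' cJ']] ub']; apply/eqP.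
by rewrite eqn_leq (ub' _ _ cc cJ) (ub _ _ cc' cJ').
Qed.

End Dimension.
(** * Identifying variables *)

Section Substitution.
Variables (K : fieldType) (n : nat).
Implicit Types (U : set 'X_{1..n}) (m w : 'X_{1..n}) (rho : 'I_n -> 'I_n).
Implicit Types (f g : {mpoly K[n]}).

Definition push rho m : 'X_{1..n} := (\sum_(j < n) U_(rho j) *+ m j)%MM.

Lemma pushE rho m k : push rho m k = (\sum_(j < n) (rho j == k) * m j)%N.
Proof. by rewrite mnm_sumE; apply: eq_bigr => j _; rewrite mulmnE mnm1E. Qed.

Lemma pushD rho m w : push rho (m + w) = (push rho m + push rho w)%MM.
Proof.
apply/mnmP => k; rewrite mnmDE !pushE -big_split /=; apply: eq_bigr => j _.
by rewrite mnmDE mulnDr.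
Qed.

Lemma push1 rho i : push rho U_(i) = U_(rho i)%MM.
Proof.
apply/mnmP => k; rewrite pushE (bigD1 i) //= !mnm1E eqxx muln1 big1 ?addn0 //.
by move=> j ji; rewrite mnm1E [i == j]eq_sym (negPf ji) muln0.
Qed.

Lemma push_le rho m w : (m <= w)%MM -> (push rho m <= push rho w)%MM.
Proof. by move/submK <-; rewrite pushD lem_addl. Qed.

Lemma push_comp rho rho' m : push rho' (push rho m) = push (rho' \o rho) m.
Proof.
apply/mnmP => k; rewrite !pushE.
under eq_bigr do rewrite pushE big_distrr /=.
rewrite exchange_big; apply: eq_bigr => j _ /=.
rewrite (bigD1 (rho j)) //= eqxx mul1n big1 ?addn0 // => i irj.
by rewrite [rho j == i]eq_sym (negPf irj) mul0n muln0.
Qed.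

Lemma push_id rho m : (forall j, (0 < m j)%N -> rho j = j) -> push rho m = m.
Proof.
move=> fix_m; rewrite [RHS]multinomUE_id; apply: eq_bigr => j _.
by have [->|/fix_m->] := posnP (m j); rewrite ?mulm0n.
Qed.

Lemma push_eq0 rho m : push rho m = 0%MM -> m = 0%MM.
Proof.
move=> /mnmP p0; apply/mnmP => j; have := p0 (rho j).
by rewrite pushE mnm0E (bigD1 j) //= eqxx mul1n mnm0E; lia.
Qed.

Definition push_up rho U : set 'X_{1..n} :=
  [set m | exists2 g, U g & (push rho g <= m)%MM].

Lemma upset_push_up rho U : upset (push_up rho U).
Proof. by move=> w m [g Ug gm]; exists g => //; apply: lepm_trans gm (lem_addl _ _). Qed.

Lemma push_up_comp rho rho' U : push_up rho' (push_up rho U) = push_up (rho' \o rho) U.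
Proof.
apply/seteqP; split=> m.
  move=> [g [g' Ug' g'g] gm]; exists g' => //.
  by rewrite -push_comp; apply: lepm_trans gm; apply: push_le.
move=> [g Ug gm]; exists (push rho g); last by rewrite push_comp.
by exists g => //; apply: lepm_refl.
Qed.

Lemma eq_push_up rho rho' U : rho =1 rho' -> push_up rho U = push_up rho' U.
Proof. by move=> /funext->. Qed.

Lemma push_up_id U : upset U -> push_up id U = U.
Proof.
move=> uU; apply/seteqP; split=> m; last by exists m; rewrite ?push_id // lepm_refl.
by move=> [g Ug]; rewrite push_id //; apply: upset_le.
Qed.

(** The ideal does not involve the variables outside of the image of [rho]. *)
Lemma push_up_free rho U m m' : (forall k, (exists j, rho j = k) -> m k = m' k) ->
  push_up rho U m -> push_up rho U m'.
Proof.
move=> mm' [g Ug gm]; exists g => //; apply/mnm_lepP => k.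
case: (pselect (exists j, rho j = k)) => [ek|nk].
  by rewrite -mm' //; apply/mnm_lepP.
rewrite pushE big1 // => j _; case: eqP => // jk; case: nk; by exists j.
Qed.

Lemma push_up0 rho U : push_up rho U 0%MM -> U 0%MM.
Proof.
case=> g Ug /mnm_lepP le0; rewrite -(@push_eq0 rho g) //; apply/mnmP => k.
by have := le0 k; rewrite mnm0E leqn0 => /eqP.
Qed.

Definition rename rho f : {mpoly K[n]} := f \mPo [tuple 'X_(rho j) | j < n].

Lemma renameX rho m : rename rho 'X_[m] = 'X_[push rho m].
Proof.
rewrite /rename comp_mpolyX /push -mprodXnE; apply: eq_bigr => j _.
by rewrite tnth_mktuple.
Qed.

Lemma renameE rho f :
  rename rho f = \sum_(m <- msupp f) f@_m *: 'X_[push rho m].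
Proof.
rewrite {1}(mpolyE f) /rename raddf_sum; apply: eq_bigr => m _ /=.
by rewrite comp_mpolyZ -/(rename _ _) renameX.
Qed.

Lemma renameM rho : {morph rename rho : f g / f * g}.
Proof. by move=> f g; rewrite /rename rmorphM. Qed.

Lemma renameB rho : {morph rename rho : f g / f - g}.
Proof. by move=> f g; rewrite /rename raddfB. Qed.

Lemma rename_ideal rho (J : set {mpoly K[n]}) :
  is_ideal J -> is_ideal [set g | J (rename rho g)].
Proof.
move=> iJ; split=> [|a b Ja Jb|r a Ja].
- by rewrite /= /rename raddf0; apply: ideal0.
- by rewrite /= /rename raddfD; apply: idealD.
- by rewrite /= renameM; apply: (idealMl _ iJ).
Qed.

Lemma mono_ideal_rename rho U :
  ideal_gen [set p | exists2 m, U m & p = rename rho 'X_[m]] =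
  mono_span (push_up rho U).
Proof.
have -> : mono_span (push_up rho U) = mono_ideal (K := K) (push rho @` U).
  rewrite mono_span_gen; congr mono_span; apply/seteqP; split=> m.
    by move=> [g Ug gm]; exists (push rho g) => //; exists g.
  by move=> [_ [g Ug <-] gm]; exists g.
congr ideal_gen; apply/seteqP; split=> p.
  by move=> [m Um ->]; rewrite renameX; exists (push rho m) => //; exists m.
by move=> [_ [m Um <-] <-]; exists m; rewrite ?renameX.
Qed.

(** Modulo the differences [X_(rho j) - X_j] every polynomial equals its image
under the renaming, and the renaming kills these differences. *)
Lemma add_gens_rename rho U (s : seq {mpoly K[n]}) g : upset U ->
  (forall d, d \in s -> rename rho d = 0) ->
  (forall j, rho j != j -> 'X_(rho j) - 'X_j \in s) ->
  add_gens (mono_span U) s g <-> mono_span (push_up rho U) (rename rho g).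
Proof.
move=> uU ds0 sd.
have iU := mono_span_ideal K uU; have iV := mono_span_ideal K (@upset_push_up rho U).
set Q := add_gens _ s; have iQ : is_ideal Q := add_gens_ideal _ s.
have QX (m : 'X_{1..n}) : Q ('X_[m] - rename rho 'X_[m]).
  rewrite mpolyXE_id.
  apply: (big_ind (fun x => Q (x - rename rho x))) => [|x y Qx Qy|i _].
  - by rewrite /rename rmorph1 subrr; apply: (ideal0 iQ).
  - rewrite renameM; have := idealD iQ (idealMl x iQ Qy) (idealMr (rename rho y) iQ Qx).
    by congr Q; ring.
  elim: (m i) => [|k IHk]; first by rewrite expr0 /rename rmorph1 subrr; apply: (ideal0 iQ).
  have Qi : Q ('X_i - rename rho 'X_i).
    rewrite renameX push1; have [->|ri] := eqVneq (rho i) i.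
      by rewrite subrr; apply: (ideal0 iQ).
    by rewrite -opprB; apply: (idealN iQ); apply: mem_add_gens; apply: sd.
  rewrite exprS renameM.
  have := idealD iQ (idealMl 'X_i iQ IHk) (idealMr (rename rho ('X_i ^+ k)) iQ Qi).
  by congr Q; ring.
split=> [Qg|Vg].
  suff QV : Q `<=` [set g | mono_span (push_up rho U) (rename rho g)] by apply: QV.
  apply: add_gens_sub => [|f Uf|d ds]; first exact: rename_ideal.
    rewrite /= renameE big_seq; apply: ideal_sum => // m fm.
    rewrite -mul_mpolyC; apply: (idealMl _ iV); apply/mono_spanX.
    by exists m; [apply: Uf|apply: lepm_refl].
  by rewrite /= ds0 //; apply: ideal0.
have Qr f : Q (f - rename rho f).
  rewrite renameE {1}(mpolyE f) -sumrB big_seq; apply: ideal_sum => // m fm.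
  rewrite -scalerBr -renameX -mul_mpolyC; apply: (idealMl _ iQ); exact: QX.
apply: (idealBr iQ (Qr g)).
rewrite (mpolyE (rename rho g)) big_seq; apply: ideal_sum => // m /Vg[u Uu /submK <-].
rewrite -mul_mpolyC mpolyXD mulrA; apply: (idealMl _ iQ).
rewrite -renameX -[X in Q X](subKr 'X_[u]); apply: (idealB iQ _ (QX u)).
by apply: sub_add_gens; apply/mono_spanX.
Qed.

Lemma add_gens_vars U (s : seq 'I_n) : upset U ->
  add_gens (mono_span U) [seq 'X_i : {mpoly K[n]} | i <- s] =
  mono_span (U `|` meets (finset (fun i => i \in s))).
Proof.
move=> uU; set A := finset _.
have uA : upset (U `|` meets A).
  by move=> w m [Um|Am]; [left; apply: uU|right; apply: upset_meets].
have iQ := add_gens_ideal (mono_span U) [seq 'X_i : {mpoly K[n]} | i <- s].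
apply/seteqP; split.
  apply: add_gens_sub; first exact: mono_span_ideal.
    by move=> f Uf m /Uf; left.
  move=> _ /mapP[i si ->]; apply/mono_spanX; right; apply/meets1.
  by rewrite finset.in_set.
move=> f Wf; have [f' [Uff' ff']] := mono_span_split U f.
apply: (idealBr iQ (@sub_add_gens _ _ _ _ Uff')).
apply: (mono_prime_sub iQ (A := A)); last first.
  by move=> m fm; have [/Wf[]] := ff' m fm.
by move=> i; rewrite finset.in_set => si; apply: mem_add_gens; apply: map_f.
Qed.

Lemma push_up_vars rho U (A : {set 'I_n}) : (forall i, i \in A -> rho i = i) ->
  push_up rho (U `|` meets A) = push_up rho U `|` meets A.
Proof.
move=> fixA; apply/seteqP; split=> m.
  move=> [g [Ug|[i iA gi]] gm]; first by left; exists g.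
  right; exists i => //; apply: leq_trans (mnm_lepP gm i).
  by rewrite pushE (bigD1 i) //= fixA // eqxx mul1n; lia.
move=> [[g Ug gm]|[i iA mi]]; first by exists g => //; left.
exists U_(i)%MM; first by right; apply/meets1.
by rewrite push1 fixA // lep1mP -lt0n.
Qed.

End Substitution.
(** * Collapsing blocks of variables *)

Section Collapse.
Variables (K : fieldType) (n : nat) (beta : 'I_n -> 'I_n).
Hypothesis beta_idem : forall j, beta (beta j) = beta j.
Implicit Types (U : set 'X_{1..n}) (m w : 'X_{1..n}) (js : seq 'I_n).

Definition moved j := beta j != j.

Definition collapse js j := if j \in js then beta j else j.

Definition diffs js : seq {mpoly K[n]} := [seq 'X_(beta j) - 'X_j | j <- js].

Lemma beta_fixed js j : all moved js -> beta j \notin js.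
Proof. by move=> /allP mjs; apply/negP => /mjs; rewrite /moved beta_idem eqxx. Qed.

Lemma collapse_notin js j : all moved js -> collapse js j \notin js.
Proof. by move=> mjs; rewrite /collapse; case: ifPn => // _; apply: beta_fixed. Qed.

Lemma collapse_id js j : j \notin js -> collapse js j = j.
Proof. by rewrite /collapse => /negPf->. Qed.

Lemma collapse_cat js js' : all moved js' ->
  collapse js' \o collapse js =1 collapse (js ++ js').
Proof.
move=> mjs' j; rewrite /= /collapse mem_cat; case: (j \in js) => //=.
by rewrite (negPf (beta_fixed _ mjs')).
Qed.

Lemma add_gens_diffs U js g : upset U -> all moved js ->
  add_gens (mono_span U) (diffs js) g <->
  mono_span (push_up (collapse js) U) (rename (collapse js) g).
Proof.
move=> uU mjs; apply: add_gens_rename => // [d /mapP[j jjs ->]|j].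
  rewrite renameB !renameX !push1 (collapse_id (beta_fixed _ mjs)).
  by rewrite /collapse jjs subrr.
rewrite {1}/collapse; case: ifP => [jjs _|_]; last by rewrite eqxx.
by rewrite /collapse jjs; apply: map_f.
Qed.

Lemma push_up_collapse_free U js m m' : all moved js ->
  (forall k, k \notin js -> m k = m' k) ->
  push_up (collapse js) U m -> push_up (collapse js) U m'.
Proof.
move=> mjs mm'; apply: push_up_free => k [j <-]; apply: mm'.
exact: collapse_notin.
Qed.

Lemma homog_pos_mono_prime (p : {mpoly K[n]}) : homog_pos p -> mono_prime finset.setT p.
Proof.
move=> [d d_gt0 pd] m pm.
have md : mdeg m = d := dhomog_mf pd pm.
apply: contrapT => nm; move: d_gt0; rewrite -md mdegE big1 // => i _.
by apply: contrapT => /eqP mi; apply: nm; exists i; rewrite ?lt0n // finset.inE.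
Qed.

(** Depth bound for a prime [P] associated to the quotient of [S/J] by a regular
sequence of differences: besides the generators of [P], the variables outside of
[A] are needed to generate an ideal with the maximal ideal as radical, and each of
them accounts for one element of [ys]. Their powers are taken so high that the
monomial with annihilator [P] does not lie in the ideal that they generate. *)
Lemma regular_length_bound U js ys m (A : {set 'I_n}) :
  upset U -> uniq js -> all moved js ->
  weakly_regular (mono_span U : set {mpoly K[n]}) ys -> {in ys, forall y, homog_pos y} ->
  weakly_regular (mono_span U) (diffs js) ->
  annihilates (push_up (collapse js) U) m A ->
  (size ys <= n - #|A|)%N.
Proof.
move=> uU ujs mjs yU ypos dU WmA; rewrite leqNgt; apply/negP => lt.
set W := push_up _ U in WmA; have uW : upset W by apply: upset_push_up.
have freeW m1 m2 : (forall k, k \notin js -> m1 k = m2 k) -> W m1 -> W m2.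
  exact: push_up_collapse_free.
(* [m0] is [m] without the variables in [js], which do not occur in the collapsed
   ideal: it has the same annihilator, and the renaming fixes it. *)
pose m0 := [multinom (if k \in js then 0 else m k)%N | k < n].
have m0E k : k \notin js -> m0 k = m k by move=> /negPf kjs; rewrite mnmE kjs.
have nW0 : ~ W m0.
  by move=> /(freeW _ m m0E); apply: annihilates_notin WmA.
have Ajs j : j \in A -> j \notin js.
  move=> jA; apply/negP => jjs; apply: (annihilates_notin WmA).
  have : W (U_(j) + m)%MM by apply/WmA/meets1.
  apply: freeW => k kjs; rewrite mnmDE mnm1E; case: eqVneq => // jk.
  by move: kjs; rewrite -jk jjs.
pose B := finset (fun b => (b \notin A) && (b \notin js)).
pose e := (mdeg m0).+1.
pose xs : seq {mpoly K[n]} := [seq 'X_b ^+ e | b <- enum B].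
pose G : set {mpoly K[n]} :=
  [set p | (exists2 a, a \in A & p = 'X_a) \/ p \in diffs js].
have sizeB : (size js + #|B| = n - #|A|)%N.
  have -> : size js = #|finset (fun j => j \in js)|.
    by rewrite -(card_uniqP ujs); apply: eq_card => j; rewrite finset.inE.
  have -> : B = (~: (A :|: finset (fun j => j \in js)))%SET.
    by apply/setP => j; rewrite !finset.inE negb_or.
  have disj : (A :&: finset (fun j => j \in js) = finset.set0)%SET.
    apply/setP => j; rewrite !finset.inE; apply/negP => /andP[/Ajs jn jy].
    by rewrite jy in jn.
  have := cardsC (A :|: finset (fun j => j \in js))%SET.
  by rewrite cardsU disj cards0 card_ord subn0 -addnA => cE; rewrite -[X in (X - _)%N]cE addKn.
have iJ := mono_span_ideal K uU.
set J := mono_span U in iJ yU dU.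
have iJd := add_gens_ideal J (diffs js).
have inJd g : add_gens J (diffs js) g <-> mono_span W (rename (collapse js) g).
  exact: add_gens_diffs.
have rename_m0 w : (forall k, k \in js -> w k = 0%N) ->
    rename (collapse js) 'X_[w] = 'X_[w] :> {mpoly K[n]}.
  move=> w0; rewrite renameX push_id // => j wj; apply: collapse_id.
  by apply/negP => /w0 w0j; rewrite w0j in wj.
have m00 k : k \in js -> m0 k = 0%N by move=> kjs; rewrite mnmE kjs.
have Gv p : G p -> add_gens J (diffs js) (p * 'X_[m0]).
  case=> [[a aA ->]|pd]; last by apply: (idealMr _ iJd); apply: mem_add_gens.
  apply/inJd; rewrite -mpolyXD rename_m0 => [|k kjs].
    apply/mono_spanX; have : W (U_(a) + m)%MM by apply/WmA/meets1.
    by apply: freeW => k kjs; rewrite !mnmDE m0E.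
  rewrite mnmDE m00 // addn0 mnm1E; case: eqVneq => // ak.
  by have := Ajs a aA; rewrite ak kjs.
have lt' : (size (diffs js) + size xs < size ys)%N.
  by rewrite !size_map -cardE sizeB.
have yG : {in ys, forall y, radical (ideal_gen (G `|` [set` xs])) y}.
  move=> y /ypos/homog_pos_mono_prime.
  set Q := radical _; have iQ : is_ideal Q.
    by apply: radical_ideal; apply: ideal_gen_ideal.
  apply: mono_prime_sub => // i _.
  have Qjs k : k \notin js -> Q 'X_k.
    move=> kjs; have [kA|kA] := boolP (k \in A).
      by apply: sub_radical; apply: sub_ideal_gen; left; left; exists k.
    exists e; apply: sub_ideal_gen; right; apply: map_f.
    by rewrite mem_enum finset.inE kA.
  have [ijs|] := boolP (i \in js); last exact: Qjs.
  rewrite -[X in Q X](subKr 'X_(beta i)); apply: (idealB iQ).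
    by apply: Qjs; apply: beta_fixed.
  by apply: sub_radical; apply: sub_ideal_gen; left; right; apply: map_f.
have vL := annihilated_by_few iJ yU dU yG lt' Gv.
pose L := W `|` [set w | exists2 b, b \in B & (e <= w b)%N].
have uL : upset L.
  move=> w w' [Ww|[b bB eb]]; first by left; apply: uW.
  by right; exists b; rewrite // mnmDE; lia.
have iL := rename_ideal (collapse js) (mono_span_ideal K uL).
have : mono_span L (rename (collapse js) 'X_[m0] : {mpoly K[n]}).
  apply: (add_gens_sub iL _ _ vL) => [g /inJd Wg w /Wg|_ /mapP[b bB ->]]; first by left.
  move: bB; rewrite mem_enum finset.inE => /andP[bA bjs].
  rewrite /= mpolyXn rename_m0 => [|k kjs].
    apply/mono_spanX; right; exists b; first by rewrite finset.inE bA.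
    by rewrite mulmnE mnm1E eqxx mul1n.
  by rewrite mulmnE mnm1E; case: eqVneq => // bk; move: bjs; rewrite bk kjs.
rewrite rename_m0 // => /mono_spanX[//|[b _]].
by rewrite /e mdegE (bigD1 b) //=; lia.
Qed.

Definition height_pure U h := forall m A, annihilates U m A -> #|A| = h.

Section Regular.
Variables (U : set 'X_{1..n}) (h : nat).
Hypothesis two_in_block : forall js m A j, all moved js ->
  annihilates (push_up (collapse js) U) m A ->
  j \in A -> beta j \in A -> moved j -> (h < #|A|)%N.

Let W js := push_up (collapse js) U.

Lemma no_block_socle js j m : all moved js -> height_pure (W js) h -> moved j ->
  W js (U_(beta j) + m)%MM -> W js (U_(j) + m)%MM -> W js m.
Proof.
move=> mjs pureW mj Wb Wj; apply: contrapT => nWm.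
have A0m i : i \in [set beta j; j]%SET -> W js (U_(i) + m)%MM.
  by rewrite !finset.inE => /orP[] /eqP->.
have [A [m' [/fintype.subsetP A0A WmA]]] :=
  exists_annihilates (@upset_push_up _ _ _) nWm A0m.
have := two_in_block mjs WmA (A0A j _) (A0A (beta j) _) mj.
by rewrite (pureW _ _ WmA) !finset.inE !eqxx orbT ltnn => /(_ isT isT).
Qed.

(** The differences are regular as soon as all intermediate ideals are pure: their
associated primes, having only [h] variables, contain one variable of each block,
hence no difference. The set [V] holds free variables that precede the
differences in the sequence. *)
Lemma diffs_regular js0 js (V : {set 'I_n}) :
  uniq js -> all moved (js0 ++ js) -> (forall i, i \in V -> beta i = i) ->
  (forall i j, i \in V -> moved j -> beta j != i) ->
  (forall s, prefix s js -> s != js -> height_pure (W (js0 ++ s)) h) ->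
  weakly_regular (mono_span (W js0 `|` meets V)) (diffs js).
Proof.
move=> + + Vfix Vfree; have uWV s : upset (W s `|` meets V).
  move=> w m [Wm|Vm]; [left; exact: upset_push_up|right; exact: upset_meets].
elim/last_ind: js => [//|js j IHjs]; rewrite rcons_uniq -rcons_cat all_rcons.
move=> /andP[jjs ujs] /andP[mj mjs] pure; rewrite /diffs map_rcons -/(diffs js); apply/weakly_regular_rcons.
  exact: mono_span_ideal.
split.
  apply: IHjs => // s sjs _; apply: pure.
    by apply: prefix_trans sjs _; rewrite prefix_rcons.
  by apply/eqP => sE; have := size_prefix sjs; rewrite sE size_rcons ltnn.
have mjs' : all moved js by move: mjs; rewrite all_cat => /andP[].
move=> g /(add_gens_diffs _ (uWV js0) mjs') Wg.
apply/(add_gens_diffs _ (uWV js0) mjs'); move: Wg; rewrite renameM renameB !renameX !push1.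
rewrite (collapse_id (beta_fixed _ mjs')) (collapse_id jjs).
have Vjs i : i \in V -> collapse js i = i.
  move=> iV; apply: collapse_id; apply/negP => ijs.
  by have /allP/(_ i ijs) := mjs'; rewrite /moved Vfix ?eqxx.
rewrite push_up_vars // push_up_comp (eq_push_up _ (collapse_cat js0 mjs')).
suff nz : nonzerodivisor (mono_span (W (js0 ++ js) `|` meets V) : set {mpoly K[n]})
    ('X_(beta j) - 'X_j) by apply: nz.
apply: (nonzerodivisor_diff _ mj) => [|m]; first exact: uWV.
have jV : j \notin V by apply/negP => /Vfix jE; move: mj; rewrite /moved jE eqxx.
have bV : beta j \notin V by apply/negP => /Vfree/(_ mj); rewrite eqxx.
case=> [Wb|/meetsD[/meets1|]]; [|by rewrite (negPf bV)|by right].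
case=> [Wj|/meetsD[/meets1|]]; [|by rewrite (negPf jV)|by right].
left; apply: no_block_socle Wb Wj => //; apply: pure; first by rewrite prefix_rcons.
by apply/eqP => /(congr1 size); rewrite size_rcons => /n_Sn.
Qed.

End Regular.
End Collapse.
(** * Monomial ideals of Koenig type *)

Section Koenig.
Variables (K : fieldType) (n h : nat) (u : h.-tuple 'X_{1..n}) (U : set 'X_{1..n}).
Variables (lead : 'I_h -> 'I_n) (A0 : {set 'I_n}).
Hypotheses (upset_U : upset U) (U_u : forall l, U (tnth u l)).
Hypothesis u_disjoint : forall l l' i,
  occurs i (tnth u l) -> occurs i (tnth u l') -> l = l'.
Hypothesis leadP : forall l, first_var (lead l) (tnth u l).
Hypotheses (U_A0 : U `<=` meets A0) (A0_le : (#|A0| <= h)%N).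

Definition block_lead j : 'I_n :=
  if [pick l | (0 < tnth u l j)%N] is Some l then lead l else j.

Local Notation beta := block_lead.

Lemma block_leadP j l : occurs j (tnth u l) -> beta j = lead l.
Proof.
rewrite /beta; case: pickP => [l' jl'|nj] jl; first by rewrite (u_disjoint jl' jl).
by have := nj l; rewrite jl.
Qed.

Lemma block_lead_free j : (forall l, ~ occurs j (tnth u l)) -> beta j = j.
Proof. by rewrite /beta => nj; case: pickP => // l /nj. Qed.

Lemma lead_occurs l : occurs (lead l) (tnth u l).
Proof. by case: (leadP l). Qed.

Lemma block_leadK j : beta (beta j) = beta j.
Proof.
case: (pselect (exists l, occurs j (tnth u l))) => [[l jl]|nj].
  by rewrite (block_leadP jl); apply: block_leadP; apply: lead_occurs.
by rewrite !block_lead_free // => l jl; apply: nj; exists l.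
Qed.

Lemma block_lead_occurs j l : occurs j (tnth u l) -> occurs (beta j) (tnth u l).
Proof. by move=> jl; rewrite (block_leadP jl); apply: lead_occurs. Qed.

Lemma moved_occurs j : moved beta j -> exists l, occurs j (tnth u l).
Proof.
move=> mj; apply: contrapT => nj; move/eqP: mj; apply; apply: block_lead_free => l jl.
by apply: nj; exists l.
Qed.

(** The monomials of the ideal in which the variables in [js] are replaced by the
first variables of their blocks. *)
Let W js := push_up (collapse beta js) U.

(** The image of [u_l] under the collapse still lies in block [l]. *)
Lemma annihilates_block js m A l : annihilates (W js) m A ->
  exists2 i, i \in A & occurs i (tnth u l).
Proof.
move=> WmA; have : W js (push (collapse beta js) (tnth u l) + m)%MM.
  rewrite addmC; apply: upset_push_up; exists (tnth u l) => //; exact: lepm_refl.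
move/WmA => [i iA]; rewrite pushE => pos; exists i => //.
apply: contrapT => nil; move: pos; rewrite big1 // => j _.
have [->|jl] := posnP (tnth u l j); first by rewrite muln0.
case: eqP => // ij; case: nil; rewrite -ij /collapse.
by case: ifP => // _; apply: block_lead_occurs.
Qed.

Lemma block_transversal js m A : annihilates (W js) m A -> exists g : 'I_h -> 'I_n,
  [/\ injective g, forall l, g l \in A & forall l, occurs (g l) (tnth u l)].
Proof.
move=> WmA; have /choice[g gP] : forall l, exists i, i \in A /\ occurs i (tnth u l).
  by move=> l; have [i iA il] := annihilates_block l WmA; exists i.
exists g; split=> l; [move=> l' gl|by case: (gP l)..].
by have [[_ gll] [_ gll']] := (gP l, gP l'); apply: u_disjoint gll _; rewrite gl.
Qed.

Lemma annihilates_card js m A : annihilates (W js) m A -> (h <= #|A|)%N.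
Proof.
move=> /block_transversal[g [ginj gA _]].
rewrite -[X in (X <= _)%N](card_ord h) -(card_codom ginj).
by apply: subset_leq_card; apply/fintype.subsetP => _ /codomP[l ->].
Qed.

(** A transversal of the blocks can be chosen to avoid [a], if [a] is not the only
variable of [A] in its block. *)
Lemma annihilates_card_extra js m A a : annihilates (W js) m A -> a \in A ->
  (forall l b, b \in A -> occurs b (tnth u l) -> occurs a (tnth u l) ->
     exists2 b', b' \in A & b' != a /\ occurs b' (tnth u l)) -> (h < #|A|)%N.
Proof.
move=> WmA aA other; have WmA' := WmA.
have /choice[g gP] : forall l, exists i, [/\ i \in A, i != a & occurs i (tnth u l)].
  move=> l; have [i iA il] := annihilates_block l WmA.
  case: (pselect (occurs a (tnth u l))) => [al|nal].
    by have [b' b'A [b'a b'l]] := other l i iA il al; exists b'.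
  by exists i; split=> //; apply/eqP => ia; apply: nal; rewrite -ia.
have ginj : injective g.
  move=> l l' gl; have [[_ _ gll] [_ _ gll']] := (gP l, gP l').
  by apply: u_disjoint gll _; rewrite gl.
rewrite -[X in (X < _)%N](card_ord h) -(card_codom ginj).
apply: proper_card; apply/fintype.properP; split.
  by apply/fintype.subsetP => _ /codomP[l ->]; case: (gP l).
exists a => //; apply/negP => /codomP[l al]; have [_] := gP l.
by rewrite -al eqxx.
Qed.

Lemma two_in_block js m A j : all (moved beta) js -> annihilates (W js) m A ->
  j \in A -> beta j \in A -> moved beta j -> (h < #|A|)%N.
Proof.
move=> _ WmA jA bA mj; apply: (annihilates_card_extra WmA jA) => l b _ _ jl.
by exists (beta j) => //; split; [|apply: block_lead_occurs].
Qed.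

Lemma free_in_prime js m A i : annihilates (W js) m A -> i \in A ->
  (forall l, ~ occurs i (tnth u l)) -> (h < #|A|)%N.
Proof. by move=> WmA iA nil; apply: (annihilates_card_extra WmA iA) => l b _ _ /nil. Qed.

Lemma W_meets js : W js `<=` meets (collapse beta js @: A0)%SET.
Proof.
move=> m [g /U_A0[i iA gi] gm]; exists (collapse beta js i); first exact: imset_f.
apply: leq_trans (mnm_lepP gm _).
by rewrite pushE (bigD1 i) //= eqxx mul1n; lia.
Qed.

Lemma meets_card js A : W js `<=` meets A -> (h <= #|A|)%N.
Proof.
move=> /(exists_annihilates_sub (@upset_push_up _ _ _))[A' [m [A'A WmA']]].
exact: leq_trans (annihilates_card WmA') (subset_leq_card A'A).
Qed.

Lemma W_meets_card js : #|(collapse beta js @: A0)%SET| = h.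
Proof.
apply/eqP; rewrite eqn_leq (meets_card (@W_meets js)) andbT.
exact: leq_trans (leq_imset_card _ _) A0_le.
Qed.

Lemma exists_pure js : exists m A, annihilates (W js) m A /\ #|A| = h.
Proof.
have [A [m [AA WmA]]] := exists_annihilates_sub (@upset_push_up _ _ _) (@W_meets js).
exists m, A; split=> //; apply/eqP; rewrite eqn_leq (annihilates_card WmA) andbT.
by rewrite -(W_meets_card js) subset_leq_card.
Qed.

Lemma h_le_n : (h <= n)%N.
Proof. by rewrite -(W_meets_card [::]) -[X in (_ <= X)%N]card_ord max_card. Qed.

Lemma W_dim js : quot_dim (mono_span (W js) : set {mpoly K[n]}) (n - h).
Proof.
rewrite -(W_meets_card js); apply: mono_quot_dim.
  by move=> f Wf m /Wf/W_meets.
move=> P prP WP; rewrite W_meets_card; apply: (@meets_card js) => m Wm.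
have Wm' : mono_span (W js) ('X_[m] : {mpoly K[n]}) by apply/mono_spanX.
have [i mi Pi] := prime_monomial prP (WP _ Wm').
by exists i => //; apply/mem_prime_vars.
Qed.

(** The associated prime of height [h] that always exists pins down the common
height of all of them. *)
Lemma unmixed_pure js :
  unmixed (mono_span (W js) : set {mpoly K[n]}) <-> height_pure (W js) h.
Proof.
split=> [[k kP] m A WmA|pureW].
  have height m' A' : annihilates (W js) m' A' -> #|A'| = k.
    move=> /(annihilates_associated K (@upset_push_up _ _ _))/kP.
    exact: prime_height_uniq (mono_prime_height K A').
  have [m' [A' [Wm'A' <-]]] := exists_pure js.
  by rewrite (height _ _ WmA) (height _ _ Wm'A').
exists h => P /(associated_mono_prime (@upset_push_up _ _ _))[A [m [-> WmA]]].
by rewrite -(pureW m A WmA); apply: mono_prime_height.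
Qed.

Lemma W_collapse0 js : push_up (collapse beta [::]) (W js) = W js.
Proof. by rewrite (@eq_push_up _ _ id) // push_up_id //; apply: upset_push_up. Qed.

Lemma regular_pure js js' ys : all (moved beta) js' -> uniq js' ->
  {in ys, forall y, homog_pos y} -> size ys = (n - h)%N ->
  weakly_regular (mono_span (W js) : set {mpoly K[n]}) ys ->
  weakly_regular (mono_span (W js)) (diffs K beta js') ->
  push_up (collapse beta js') (W js) = W (js ++ js') ->
  height_pure (W (js ++ js')) h.
Proof.
move=> mjs' ujs' ypos szy yW dW WE m A WmA; rewrite -WE in WmA.
have := regular_length_bound block_leadK (@upset_push_up _ _ _) ujs' mjs' yW ypos dW WmA.
have := h_le_n; have : (#|A| <= n)%N by rewrite -[X in (_ <= X)%N]card_ord max_card.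
rewrite WE in WmA; have := annihilates_card WmA; rewrite szy; lia.
Qed.

Lemma quot_CM_regular js : quot_CM (mono_span (W js) : set {mpoly K[n]}) ->
  exists ys, [/\ {in ys, forall y, homog_pos y}, size ys = (n - h)%N
               & weakly_regular (mono_span (W js) : set {mpoly K[n]}) ys].
Proof.
move=> [d dimd [[ys [ypos yreg szy]] _]]; exists ys; split=> //.
  by rewrite szy; apply: quot_dim_uniq dimd (W_dim js).
by have /regular_seqP[] := yreg; first exact: mono_span_ideal (@upset_push_up _ _ _).
Qed.

Lemma CM_pure js : quot_CM (mono_span (W js) : set {mpoly K[n]}) ->
  height_pure (W js) h.
Proof.
move=> /quot_CM_regular[ys [ypos szy yW]].
have := @regular_pure js [::] ys isT isT ypos szy yW I.
by rewrite cats0; apply; apply: W_collapse0.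
Qed.

Let W0 : W [::] = U.
Proof. by rewrite /W (@eq_push_up _ _ id) // push_up_id. Qed.

(** Along the prefixes of [js]: if the differences are regular so far, the depth
bound makes the collapsed ideal pure, and purity makes the next difference
regular. *)
Lemma CM_pure_all js : quot_CM (mono_span U : set {mpoly K[n]}) ->
  all (moved beta) js -> height_pure (W js) h.
Proof.
rewrite -[in quot_CM _]W0 => /quot_CM_regular[ys [ypos szy yU]] mjs.
have -> : W js = W (undup js).
  by apply: eq_push_up => j; rewrite /collapse mem_undup.
have {mjs} : all (moved beta) (undup js).
  by apply/allP => j; rewrite mem_undup; apply: (allP mjs).
have := undup_uniq js; move: (undup js) => {}js.
suff H s : prefix s js -> uniq js -> all (moved beta) js -> height_pure (W s) h.
  exact: H (prefix_refl js).
elim/last_ind: js s => [|js j IHjs] s + ujs mjs.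
  rewrite prefixs0 => /eqP->; apply: (@regular_pure [::] [::] ys) => //.
  exact: W_collapse0.
have mjs' : all (moved beta) js by move: mjs; rewrite all_rcons => /andP[].
have ujs' : uniq js by move: ujs; rewrite rcons_uniq => /andP[].
have pureW t : prefix t (rcons js j) -> t != rcons js j -> height_pure (W t) h.
  move=> tp /eqP tn; apply: IHjs => //; move: tp => /prefixP[r rE].
  case/lastP: r rE => [|r x] rE; first by rewrite cats0 in rE; case: tn.
  move: rE; rewrite -rcons_cat => /rcons_inj[-> _]; exact: prefix_prefix.
have [->|/eqP sn] := eqVneq s (rcons js j); last by move=> sp; apply: pureW => //; apply/eqP.
move=> _; apply: (@regular_pure [::] (rcons js j) ys) => //; last first.
  by rewrite W0.
have := @diffs_regular K n beta block_leadK U h two_in_block [::] (rcons js j)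
  finset.set0 ujs mjs.
have -> : push_up (collapse beta [::]) U `|` meets finset.set0 = W [::].
  apply/seteqP; split=> m; last by left.
  by move=> [//|[i]]; rewrite finset.inE.
by apply=> // i; rewrite finset.inE.
Qed.

Definition free_vars : seq 'I_n := [seq i <- enum 'I_n | [forall l, tnth u l i == 0%N]].
Definition moved_vars := [seq j <- enum 'I_n | moved beta j].

Lemma mem_free_vars i : i \in free_vars <-> forall l, ~ occurs i (tnth u l).
Proof.
rewrite mem_filter mem_enum andbT; split=> [/forallP ni l|ni].
  by rewrite /occurs (eqP (ni l)).
by apply/forallP => l; rewrite -leqn0 leqNgt; apply/negP/ni.
Qed.

Lemma moved_vars_moved : all (moved beta) moved_vars.
Proof. exact: filter_all. Qed.

(** The variables that are neither free nor moved are the [h] leads. *)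
Lemma size_free_moved : (size free_vars + size moved_vars)%N = (n - h)%N.
Proof.
pose F := [seq i <- enum 'I_n | i \in codom lead].
have lead_inj : injective lead.
  by move=> l l' e; apply: (u_disjoint (lead_occurs l)); rewrite e; apply: lead_occurs.
have sF : size F = h.
  have -> : F = enum (codom lead) by rewrite /F enumT.
  by rewrite -cardE card_codom // card_ord.
have : (size (free_vars ++ moved_vars ++ F) = n)%N.
  rewrite -[RHS]size_enum_ord; apply/perm_size/uniq_perm.
  - have uf P : uniq [seq i <- enum 'I_n | P i] by rewrite filter_uniq ?enum_uniq.
    rewrite !cat_uniq !uf /= andbT; apply/andP; split.
      apply/hasPn => i; rewrite mem_cat => /orP[] /=.
        rewrite mem_filter => /andP[/moved_occurs[l il] _]; apply/negP.
        by move=> /mem_free_vars/(_ l).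
      rewrite mem_filter => /andP[/codomP[l ->] _]; apply/negP => /mem_free_vars/(_ l).
      by apply; apply: lead_occurs.
    apply/hasPn => i; rewrite mem_filter => /andP[/codomP[l ->] _] /=.
    by rewrite mem_filter /moved (block_leadP (lead_occurs l)) eqxx.
  - exact: enum_uniq.
  move=> i; rewrite !mem_cat mem_enum; apply/idP; apply/or3P.
  case: (pselect (forall l, ~ occurs i (tnth u l))) => [/mem_free_vars|]; first by constructor 1.
  move/existsNP => [l /contrapT il].
  have [mi|/negPn/eqP bi] := boolP (moved beta i).
    by constructor 2; rewrite mem_filter mi mem_enum.
  by constructor 3; rewrite mem_filter -bi (block_leadP il) codom_f mem_enum.
by rewrite !size_cat sF; lia.
Qed.

Lemma free_vars_regular js (s : seq 'I_n) : all (moved beta) js ->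
  height_pure (W js) h -> uniq s -> {subset s <= free_vars} ->
  weakly_regular (mono_span (W js)) [seq 'X_i : {mpoly K[n]} | i <- s].
Proof.
move=> mjs pureW; have uW : upset (W js) by apply: upset_push_up.
elim/last_ind: s => [//|s a IHs]; rewrite rcons_uniq map_rcons => /andP[as_ us] sub.
apply/weakly_regular_rcons; first exact: mono_span_ideal.
split; first by apply: IHs => // i si; apply: sub; rewrite mem_rcons inE si orbT.
rewrite add_gens_vars // => g; rewrite mulrC => /mono_spanMX Wg m /Wg.
have afree : forall l, ~ occurs a (tnth u l).
  by apply/mem_free_vars; apply: sub; rewrite mem_rcons inE eqxx.
case=> [Wam|/meetsD[/meets1|]]; [|by rewrite finset.inE (negPf as_)|by right].
left; apply: contrapT => nWm.
have A0m i : i \in [set a]%SET -> W js (U_(i) + m)%MM by rewrite finset.inE => /eqP->.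
have [A [m' [/fintype.subsetP aA WmA]]] := exists_annihilates uW nWm A0m.
have := free_in_prime WmA (aA a _) afree.
by rewrite (pureW _ _ WmA) finset.inE eqxx ltnn => /(_ isT).
Qed.

(** The special system of parameters, free variables first, is a regular sequence
of the length that the dimension demands. *)
Lemma pure_CM js : (forall s, all (moved beta) s -> height_pure (W s) h) ->
  all (moved beta) js -> quot_CM (mono_span (W js) : set {mpoly K[n]}).
Proof.
move=> pureW mjs; exists (n - h)%N; first exact: W_dim.
have uW : upset (W js) by apply: upset_push_up.
have iW := mono_span_ideal K uW.
split; last first.
  move=> ys ypos /(regular_seqP _ iW)[yW _].
  have [m [A [WmA <-]]] := exists_pure js.
  apply: (@regular_length_bound K n beta block_leadK (W js) [::] ys m) => //.
  by rewrite W_collapse0.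
pose V := finset (fun i => i \in free_vars).
exists ([seq 'X_i | i <- free_vars] ++ diffs K beta moved_vars); split.
- move=> f; rewrite mem_cat => fs; exists 1%N => //; case/orP: fs => /mapP[i _ ->].
    by rewrite dhomogX /= mdeg1.
  by apply: rpredB; rewrite dhomogX /= mdeg1.
- have Vfix i : i \in V -> beta i = i.
    by rewrite finset.inE => /mem_free_vars/block_lead_free.
  have uWV : upset (W js `|` meets V).
    by move=> w m [Wm|Vm]; [left; apply: uW|right; apply: upset_meets].
  apply/regular_seqP => //; split; last first.
    rewrite add_gens_cat add_gens_vars // -/V.
    move=> /(add_gens_diffs block_leadK _ uWV moved_vars_moved).
    rewrite /rename rmorph1 => /(_ 0%MM); rewrite msupp1 inE eqxx => /(_ isT).
    by move=> /push_up0[/push_up0/U_A0|]; apply: meets0.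
  apply/weakly_regular_cat => //; split.
    by apply: free_vars_regular => //; [apply: pureW|rewrite filter_uniq ?enum_uniq].
  rewrite add_gens_vars // -/V.
  apply: (@diffs_regular K n beta block_leadK U h two_in_block js moved_vars V) => //.
  + by rewrite filter_uniq ?enum_uniq.
  + by rewrite all_cat mjs moved_vars_moved.
  + move=> i j; rewrite finset.inE => /mem_free_vars ni /moved_occurs[l jl].
    by apply/eqP => bi; apply: (ni l); rewrite -bi; apply: block_lead_occurs.
  + move=> s /prefixP[r rE] _; apply: pureW; rewrite all_cat mjs /=.
    by have := moved_vars_moved; rewrite rE all_cat => /andP[].
- by rewrite size_cat !size_map size_free_moved.
Qed.

(** * The ideals [I_B] *)

Lemma mcoeff_diff (i j k : 'I_n) :
  ('X_i - 'X_j : {mpoly K[n]})@_U_(k) = (i == k)%:R - (j == k)%:R.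
Proof. by rewrite mcoeffB !mcoeffXU. Qed.

(** In characteristic two the order is what distinguishes [x_i - x_j] from
[x_j - x_i]. *)
Lemma diff_inj (i j a b : 'I_n) : (i < j)%N -> (a < b)%N ->
  'X_i - 'X_j = 'X_a - 'X_b :> {mpoly K[n]} -> i = a /\ j = b.
Proof.
move=> ij ab E; have ijF : (i == j) = false by rewrite -val_eqE ltn_eqF.
have := congr1 (mcoeff U_(j)%MM) E; have := congr1 (mcoeff U_(i)%MM) E.
rewrite !mcoeff_diff !eqxx [j == i]eq_sym ijF subr0 sub0r.
have [-> _|ai] := eqVneq a i.
  rewrite ijF sub0r => /oppr_inj/eqP.
  by case: (eqVneq b j) => [->//|_]; rewrite oner_eq0.
rewrite sub0r; case: (eqVneq b i) => [bi _|_ /eqP]; last by rewrite oppr0 oner_eq0.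
rewrite bi ijF subr0 => /eqP; case: (eqVneq a j) => [aj _|_].
  by move: ab; rewrite bi aj => /(ltn_trans ij); rewrite ltnn.
by rewrite oppr_eq0 oner_eq0.
Qed.

Lemma diff_neq_var (i j a : 'I_n) : i != j -> 'X_i - 'X_j <> 'X_a :> {mpoly K[n]}.
Proof.
move=> ij E.
have := congr1 (mcoeff U_(j)%MM) E; have := congr1 (mcoeff U_(i)%MM) E.
rewrite !mcoeff_diff !mcoeffXU !eqxx [j == i]eq_sym (negPf ij) subr0 sub0r.
case: (eqVneq a i) => [->|_ /eqP]; last by rewrite oner_eq0.
by rewrite (negPf ij) => _ /eqP; rewrite oppr_eq0 oner_eq0.
Qed.

Lemma block_lead_lt j : moved beta j -> (beta j < j)%N.
Proof.
move=> mj; have [l jl] := moved_occurs mj; have [_ /(_ j jl)] := leadP l.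
by rewrite ltn_neqAle -(block_leadP jl) => ->; rewrite andbT.
Qed.

Definition replaced (B : set {mpoly K[n]}) :=
  [seq j <- enum 'I_n | moved beta j && ('X_(beta j) - 'X_j \in B)].

Lemma mem_replaced (B : set {mpoly K[n]}) j :
  j \in replaced B <-> moved beta j /\ B ('X_(beta j) - 'X_j).
Proof.
rewrite mem_filter mem_enum andbT; split=> [/andP[-> /set_mem]//|[-> Bj]].
exact: mem_set.
Qed.

Lemma repl_collapse (B : set {mpoly K[n]}) : B `<=` special_sop u ->
  repl B =1 collapse beta (replaced B).
Proof.
move=> Bsop j; rewrite /repl; case: pickP => [i /andP[ij /set_mem Bij]|none] /=.
  case: (Bsop _ Bij) => [[a [_ /diff_neq_var]]|[l [a [b [[al amin] bl ba E]]]]].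
    by case; rewrite -val_eqE ltn_eqF.
  have ab : (a < b)%N by rewrite ltn_neqAle amin // andbT eq_sym.
  have [ia jb] := diff_inj ij ab E; subst a b.
  have bj : beta j = i.
    rewrite (block_leadP bl); have [ll lmin] := leadP l; apply/val_inj/eqP.
    by rewrite /= eqn_leq lmin // amin.
  rewrite /collapse (_ : j \in _) //; apply/mem_replaced.
  by rewrite /moved bj -val_eqE ltn_eqF.
rewrite /collapse; case: ifP => // /mem_replaced[mj Bj].
by have := none (beta j); rewrite block_lead_lt // mem_set.
Qed.

Lemma repl_ideal_collapse (B : set {mpoly K[n]}) : B `<=` special_sop u ->
  repl_ideal (mono_span U) B = mono_span (W (replaced B)).
Proof.
move=> /repl_collapse E; rewrite /W -(eq_push_up _ E) -mono_ideal_rename.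
congr ideal_gen; apply/seteqP; split=> p [m Um pE]; exists m => //.
  by move/mono_spanX: Um.
exact/mono_spanX.
Qed.

(** Every set of moved variables is the one that some [B] replaces; this lets
unmixedness of the [I_B] control all intermediate collapsed ideals. *)
Lemma exists_sop_subset js : all (moved beta) js ->
  exists2 B : set {mpoly K[n]}, B `<=` special_sop u & W (replaced B) = W js.
Proof.
move=> /allP mjs.
exists [set f | exists2 j, j \in js & f = 'X_(beta j) - 'X_j].
  move=> _ [j /mjs mj ->]; right; have [l jl] := moved_occurs mj.
  exists l, (beta j), j; split=> //; last by rewrite eq_sym.
  by rewrite (block_leadP jl).
apply: eq_push_up => j; rewrite /collapse (_ : (j \in replaced _) = (j \in js)) //.
apply/idP/idP => [/mem_replaced[mj [k kjs]]|jjs]; last first.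
  by apply/mem_replaced; split; [apply: mjs|exists j].
by move=> /diff_inj[||_ ->//]; apply: block_lead_lt; last exact: mjs.
Qed.

Theorem koenig_CM_equiv :
  [<-> quot_CM (mono_span U : set {mpoly K[n]});
       forall B : set {mpoly K[n]},
         B `<=` special_sop u -> quot_CM (repl_ideal (mono_span U) B);
       forall B : set {mpoly K[n]},
         B `<=` special_sop u -> unmixed (repl_ideal (mono_span U) B)].
Proof.
have mrep B : all (moved beta) (replaced B).
  by apply/allP => j /mem_replaced[].
tfae.
- move=> CM B Bsop; rewrite repl_ideal_collapse //; apply: pure_CM => // s ms.
  exact: CM_pure_all.
- move=> CM B Bsop; have := CM B Bsop; rewrite repl_ideal_collapse //.
  by move=> /CM_pure/unmixed_pure.
- move=> unm; rewrite -W0; apply: pure_CM => // s /exists_sop_subset[B Bsop WB].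
  by apply/unmixed_pure; rewrite -WB -repl_ideal_collapse //; apply: unm.
Qed.

End Koenig.

Section KoenigData.
Variables (K : fieldType) (n h : nat) (u : h.-tuple 'X_{1..n}) (U : set 'X_{1..n}).
Hypothesis upset_U : upset U.
Hypothesis U_koenig : koenig_type (mono_span U : set {mpoly K[n]}) u.

(** A generator properly dividing [m] would make [m] redundant in [G]. *)
Lemma min_gens_minimal m : min_gens (mono_span U : set {mpoly K[n]}) m ->
  U m /\ forall m', U m' -> (m' <= m)%MM -> m' = m.
Proof.
move=> [G [UG minG] Gm]; move: UG; rewrite mono_span_gen => UG.
have UE w : U w <-> exists2 g, G g & (g <= w)%MM.
  by rewrite -[U w](propext (mono_spanX K U w)) UG; apply: mono_spanX.
split=> [|m' /UE[g Gg gm'] m'm]; first by apply/UE; exists m => //; apply: lepm_refl.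
have gm := lepm_trans gm' m'm.
suff gE : g = m.
  rewrite gE in gm'; apply/mnmP => i; apply/eqP.
  by rewrite eqn_leq (mnm_lepP m'm) (mnm_lepP gm').
apply: contrapT => gm_neq.
have GD : G `\ m = G.
  apply: minG; first by move=> ? [].
  rewrite UG mono_span_gen; congr mono_span; apply/seteqP; split=> w [k Gk kw].
    have [km|km] := eqVneq k m.
      by exists g; [split|apply: lepm_trans kw; rewrite km].
    by exists k => //; split=> //; apply/eqP.
  by case: Gk => Gk _; exists k.
have : (G `\ m) m by rewrite GD.
by case=> _; apply.
Qed.

Lemma koenig_proper : ~ U 0%MM.
Proof.
case: U_koenig => [[[P [[iP P1 _] UP _]] _] _ _] U0; apply: P1; apply: UP.
by rewrite -mpolyX0; apply/mono_spanX.
Qed.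

Lemma koenig_gens l : U (tnth u l).
Proof. by case: U_koenig => _ /(_ l)/min_gens_minimal[]. Qed.

Lemma koenig_lead : exists lead : 'I_h -> 'I_n, forall l, first_var (lead l) (tnth u l).
Proof.
suff /choice[lead leadP] : forall l, exists i, first_var i (tnth u l) by exists lead.
move=> l.
have [i0 i0l] : exists i0, (0 < tnth u l i0)%N.
  apply: contrapT => nex; apply: koenig_proper; suff <- : tnth u l = 0%MM by apply: koenig_gens.
  apply/mnmP => i; rewrite mnm0E; apply/eqP; rewrite -leqn0 leqNgt; apply/negP => il.
  by apply: nex; exists i.
have [i il imin] := @arg_minnP _ i0 (fun i => (0 < tnth u l i)%N) (fun i => i : nat) i0l.
by exists i; split.
Qed.

(** If [x_i] divides [u_l] and [u_l'] then [u_l' * (u_l / x_i)] is a multiple of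
[u_l]; regularity then puts the proper divisor [u_l / x_i] of the minimal
generator [u_l] into the ideal. *)
Lemma koenig_disjoint l l' i :
  occurs i (tnth u l) -> occurs i (tnth u l') -> l = l'.
Proof.
wlog ll' : l l' / (l < l')%N => [H|].
  have [lt|lt|/val_inj//] := ltngtP l l'; first exact: H.
  by move=> il il'; apply/esym; apply: (H l' l).
move=> il il'; exfalso; case: U_koenig => _ gen [reg _].
pose s : seq {mpoly K[n]} := [seq 'X_[m] | m <- u].
have iU := mono_span_ideal K upset_U.
have sE (k : 'I_h) : s`_k = 'X_[tnth u k].
  by rewrite (nth_map (tnth u k)) ?size_tuple // -tnth_nth.
pose w := (tnth u l - U_(i))%MM.
have wE : (w + U_(i) = tnth u l)%MM by rewrite submK // lep1mP -lt0n.
have wE' : (tnth u l' - U_(i) + U_(i) = tnth u l')%MM by rewrite submK // lep1mP -lt0n.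
have sl' : (l' < size s)%N by rewrite size_map size_tuple.
have : add_gens [set 0] (take l' s) 'X_[w].
  apply: (reg l' sl').
  rewrite -/s sE -mpolyXD -wE' -addmA [(U_(i) + w)%MM]addmC wE mpolyXD -sE.
  apply: (idealMl _ (add_gens_ideal _ _)); apply: mem_add_gens.
  by rewrite -(nth_take 0 ll') mem_nth // size_takel // ltnW.
move=> /(add_gens_sub iU) Uw; have {}Uw : U w.
  apply/(mono_spanX K); apply: Uw => [_ ->|_ /mem_take/mapP[m um ->]].
    exact: ideal0.
  by apply/mono_spanX; have /tnthP[k ->] := um; apply: koenig_gens.
have [_ /(_ w Uw)] := min_gens_minimal (gen l).
rewrite lem_subr => /(_ isT) wl; have := congr1 (fun m : 'X_{1..n} => m i) wE.
by rewrite wl mnmDE mnm1E eqxx; lia.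
Qed.

Lemma koenig_height : exists2 A0, U `<=` meets A0 & (#|A0| <= h)%N.
Proof.
case: U_koenig => [[[P [prP UP Ph]] _] _ _].
exists (prime_vars P); last exact: prime_vars_card.
move=> m Um; have Um' : mono_span U ('X_[m] : {mpoly K[n]}) by apply/mono_spanX.
have [i mi Pi] := prime_monomial prP (UP _ Um').
by exists i => //; apply/mem_prime_vars.
Qed.

End KoenigData.

Theorem theorem2p1 (K : fieldType) (n h : nat) (I : set {mpoly K[n]})
    (u : h.-tuple 'X_{1..n})
    (I_monomial : monomial_ideal I) (I_koenig : koenig_type I u) :
  [<-> quot_CM I;
       forall B : set {mpoly K[n]},
         B `<=` special_sop u -> quot_CM (repl_ideal I B);
       forall B : set {mpoly K[n]},
         B `<=` special_sop u -> unmixed (repl_ideal I B)].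
Proof.
case: I_monomial I_koenig => G ->; rewrite mono_span_gen => koenig.
have uU := @upset_gen n G.
have [lead leadP] := koenig_lead koenig.
have [A0 U_A0 A0_le] := koenig_height koenig.
exact: (koenig_CM_equiv K uU (koenig_gens koenig) (koenig_disjoint uU koenig)
  leadP U_A0 A0_le).
Qed.
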